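(* Let $(y_n)_{n\ge 0}$ be an inhomogeneous Markov chain on $\mathbb{R}^D$, with step sequence $(\gamma_n)_{n\ge1}$, operators $\mathcal L_n$ and interpolated laws $(\mu_t)_{t\ge0}$, and let $(P_t)_{t\ge 0}$ be the semigroup of a homogeneous Markov process on $\mathbb{R}^D$ with generator $\mathcal L$, domain $\mathcal D(\mathcal L)$ and semiflow $\Phi(\nu,t)=\nu P_t$, all as defined in the context. Let $d_1,N_1,N_2$ be multi-indices with $N_1\le N_2$. Assume: (1) (Convergence of generators) There exist a non-increasing sequence $(\epsilon_n)_{n\ge1}$ converging to $0$ and a constant $M_1$ (depending on $\mathscr L(y_0)$) such that for all $f\in\mathcal D(\mathcal L)\cap\mathscr C_b^{N_1}$, all $n\ge 1$ and all $y\in\mathrm{Supp}(\mathscr L(y_n))$, $$|\mathcal L f(y)-\mathcal L_nf(y)|\le M_1\,\chi_{d_1}(y)\sum_{j\le N_1}\|f^{(j)}\|_\infty\,\epsilon_n .$$ (2) (Regularity of the limit semigroup) For all $T>0$ there exists a constant $C_T$ such that, for every $t\le T$, every multi-index $j\le N_1$ and every $f\in\mathscr C_b^{N_2}$, one has $P_tf\in\mathscr C_b^{N_1}$ and $|(P_tf)^{(j)}(y)|\le C_T\sum_{i\le N_2}\|f^{(i)}\|_\infty$ for all $y\in\mathbb{R}^D$. (3) (Uniform boundedness of moments) There exists a multi-index $d\ge d_1$ such that one of the following holds: (i) there is a constant $M_2$ (depending on $\mathscr L(y_0)$) such that $\sup_{n\ge0}\mathbb{E}[\chi_d(y_n)]\le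 M_2$; or (ii) there is $V:\mathbb{R}^D\to\mathbb{R}_+$ such that $\mathbb{E}[V(y_n)]<+\infty$ for all $n\ge0$, and there exist $n_0\ge1$ and $a,\alpha,\beta>0$ such that $V(y)\ge\chi_d(y)$ when $|y|>a$ and, for all $n\ge n_0$ and $y\in\mathrm{Supp}(\mathscr L(y_n))$, $\mathcal L_nV(y)\le-\alpha V(y)+\beta$. Let $$\mathscr F=\Big\{f\in\mathcal D(\mathcal L)\cap\mathscr C_b^{N_2}:\ \mathcal Lf\in\mathcal D(\mathcal L),\ \|\mathcal Lf\|_\infty+\|\mathcal L\mathcal Lf\|_\infty+\sum_{j\le N_2}\|f^{(j)}\|_\infty\le1\Big\}.$$ Then $(\mu_t)_{t\ge0}$ is an asymptotic pseudotrajectory of $\Phi$ with respect to $d_{\mathscr F}$. Moreover, if $\lambda(\gamma,\epsilon)>0$, then $(\mu_t)_{t\ge0}$ is a $\lambda(\gamma,\epsilon)$-pseudotrajectory of $\Phi$ with respect to $d_{\mathscr F}$.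
   Context: Multi-indices: elements $N=(N_1,\dots,N_D)\in\mathbb{N}^D$, ordered componentwise; an integer $N$ is identified with $(N,\dots,N)$. $\mathscr C^N$ is the set of $f:\mathbb{R}^D\to\mathbb{R}$ that are $N_i$ times continuously differentiable in direction $i$; $f^{(N)}=\partial^{|N|}f/\partial_{x_1}^{N_1}\cdots\partial_{x_D}^{N_D}$ with $|N|=\sum_iN_i$; $\|\cdot\|_\infty$ is the sup norm; $\mathscr C_b^N$ is the set of $f\in\mathscr C^N$ with $\sum_{j\le N}\|f^{(j)}\|_\infty<\infty$. $\chi_N(x)=\sum_{i=1}^D\sum_{k=0}^{N_i}|x_i|^k$. $\mathscr L(X)$ is the law of $X$ and $\mathrm{Supp}$ its support. Limit process: $(X_t)_{t\ge0}$ is a homogeneous Markov process on $\mathbb{R}^D$ with a.s. càdlàg trajectories, $P_tf(x)=\mathbb{E}[f(X_t)\mid X_0=x]$. The domain $\mathcal D(\mathcal L)$ is the set of (bounded measurable) functions $f$ for which there is a (bounded measurable) function $\mathcal Lf$ with $\lim_{t\to0}\|t^{-1}(P_tf-f)-\mathcal Lf\|_\infty=0$; $\mathcal L$ is the generator. The semiflow is $\Phi(\nu,t)=\nu P_t$ for probability measures $\nu$ and $t\ge0$. Chain: $(\gamma_n)_{n\ge1}$ is a non-increasing sequence of positive numbers converging to $0$ with $\sum_n\gamma_n=+\infty$; $\mathcal L_nf(y)=\gamma_{n+1}^{-1}\mathbb{E}[f(y_{n+1})-f(y_n)\mid y_n=y]$ (through the transition kernel of the chain at step $n$, whenever the expectation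 makes sense). Put $\tau_0=0$, $\tau_n=\sum_{k=1}^n\gamma_k$, $Y_t=y_n$ for $t\in[\tau_n,\tau_{n+1})$, $\mu_t=\mathscr L(Y_t)$. For a class $\mathscr F$ of functions, $d_{\mathscr F}(\mu,\nu)=\sup_{f\in\mathscr F}|\mu(f)-\nu(f)|$. $(\mu_t)$ is an asymptotic pseudotrajectory of $\Phi$ with respect to $d$ if for every $T>0$, $\lim_{t\to\infty}\sup_{0\le s\le T}d(\mu_{t+s},\Phi(\mu_t,s))=0$. For $\lambda>0$, it is a $\lambda$-pseudotrajectory of $\Phi$ with respect to $d$ if for every $T>0$, $\limsup_{t\to\infty}\frac1t\log\big(\sup_{0\le s\le T}d(\mu_{t+s},\Phi(\mu_t,s))\big)\le-\lambda$. For non-increasing sequences $\gamma,\epsilon$ converging to $0$, $\lambda(\gamma,\epsilon)=-\limsup_{n\to\infty}\dfrac{\log(\gamma_n\vee\epsilon_n)}{\sum_{k=1}^n\gamma_k}$, where $x\vee y=\max(x,y)$. *)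

(* Defs.v *)
From HB Require Import structures.
From mathcomp Require Import all_boot all_order all_algebra.
From mathcomp Require Import all_classical all_reals all_analysis.

Set Implicit Arguments.
Unset Strict Implicit.
Unset Printing Implicit Defensive.
Import Order.TTheory GRing.Theory Num.Theory.
Import numFieldNormedType.Exports.

Local Open Scope classical_set_scope.
Local Open Scope ring_scope.

(* [borel R D] is R^D (convertible to ['rV[R]_D]) with its Borel sigma-algebra;
   the topology, norm and derivatives live on ['rV[R]_D] itself. *)
Notation borel R D := (g_sigma_algebraType (@open 'rV[R]_D)).

Definition multi_index (D : nat) := 'I_D -> nat.

Definition mi_le D (M N : multi_index D) := forall i, (M i <= N i)%N.

Section FunctionSpaces.
Context {R : realType} {D : nat}.
Implicit Types (f g : 'rV[R]_D -> R) (N j : multi_index D).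

Definition supnorm f : \bar R := ereal_sup [set `|f x|%:E | x in [set: 'rV[R]_D]].

Definition basis_vec (i : 'I_D) : 'rV[R]_D := delta_mx ord0 i.

(* The head of [s] is the last direction of differentiation. *)
Definition iter_partial (s : seq 'I_D) f : 'rV[R]_D -> R :=
  foldr (fun i g => 'D_(basis_vec i) g) f s.

Definition mi_dirs j : seq 'I_D := flatten [seq nseq (j i) i | i <- enum 'I_D].

Definition mpartial j f : 'rV[R]_D -> R := iter_partial (mi_dirs j) f.

(* All the mixed partial derivatives using direction [i] at most [N i] times, in
   any order, exist and are continuous. The existence of the mixed derivatives
   is what gives a meaning to f^(j) for every j <= N. As ['D_v] is total, each
   differentiation step must be required to be [derivable]. *)
Definition class_C N f :=
  forall s : seq 'I_D, (forall i, (count_mem i s <= N i)%N) ->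
    continuous (iter_partial s f) /\
    forall i, (count_mem i s < N i)%N ->
      forall x, derivable (iter_partial s f) x (basis_vec i).

(* The index type is the finite set of multi-indices j <= N. *)
Definition Cnorm N f : \bar R :=
  (\sum_(j : {dffun forall i : 'I_D, 'I_(N i).+1})
    supnorm (mpartial (fun i => j i) f))%E.

Definition class_Cb N : set ('rV[R]_D -> R) :=
  [set f | class_C N f /\ (Cnorm N f < +oo)%E].

Definition chi N (x : 'rV[R]_D) : R :=
  \sum_(i < D) \sum_(0 <= k < (N i).+1) `|x ord0 i| ^+ k.

Definition euclidean_norm (x : 'rV[R]_D) : R :=
  Num.sqrt (\sum_(i < D) x ord0 i ^+ 2).

Definition bounded_measurable f :=
  measurable_fun [set: borel R D] (f : borel R D -> R) /\ (supnorm f < +oo)%E.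

Definition msupport (mu : probability (borel R D) R) : set 'rV[R]_D :=
  [set x | forall U : set 'rV[R]_D, open U -> U x -> (0 < mu U)%E].

End FunctionSpaces.

Section Processes.
Context {R : realType} {D : nat}.
Local Notation E := (borel R D).

Definition sigma_of {d} {Omega : measurableType d} {I : Type}
    (X : I -> Omega -> E) (J : set I) : set (set Omega) :=
  <<s \bigcup_(i in J) preimage_set_system [set: Omega] (X i) measurable >>.

(* [K n] is the transition kernel from time [n] to time [n.+1]. *)
Definition markov_chain {d} {Omega : measurableType d} (P : probability Omega R)
    (K : nat -> R.-pker E ~> E) (y : nat -> {RV P >-> E}) :=
  forall n A B, sigma_of (fun k => y k : Omega -> E) [set k | (k <= n)%N] A ->
    measurable B ->
    P (A `&` y n.+1 @^-1` B) = (\int[P]_(w in A) K n (y n w) B)%E.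

Definition cadlag (x : R -> 'rV[R]_D) :=
  (forall t, 0 <= t -> x s @[s --> t^'+] --> x t) /\
  (forall t, 0 < t -> cvg (x s @[s --> t^'-])).

(* A Markov family: [Q x] is the law under which the process starts from [x],
   and [Pt t] is the transition kernel over a time [t]. Only times [t >= 0] are
   meaningful. *)
Definition homogeneous_markov_process {d} {Omega : measurableType d}
    (Pt : R -> R.-pker E ~> E) (Q : E -> probability Omega R)
    (X : R -> {mfun Omega >-> E}) :=
  [/\ forall x, {ae Q x, forall w, X 0 w = x},
      forall t x B, 0 <= t -> measurable B -> Pt t x B = Q x (X t @^-1` B),
      forall x s t A B, 0 <= s -> 0 <= t ->
        sigma_of (fun r => X r : Omega -> E) [set r | 0 <= r <= s] A ->
        measurable B ->
        Q x (A `&` X (s + t) @^-1` B) = (\int[Q x]_(w in A) Pt t (X s w) B)%E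
    & forall x, {ae Q x, forall w, cadlag (fun t => X t w : 'rV[R]_D)}].

Definition semigroup (Pt : R -> R.-pker E ~> E) (t : R) (f : 'rV[R]_D -> R) :
    'rV[R]_D -> R :=
  fun x => \int[Pt t x]_z f z.

Definition is_generator (Pt : R -> R.-pker E ~> E) (f g : 'rV[R]_D -> R) :=
  [/\ bounded_measurable f, bounded_measurable g &
    supnorm (fun x => t^-1 * (semigroup Pt t f x - f x) - g x)
      @[t --> (0:R)^'+] --> 0%E].

Definition generator_domain (Pt : R -> R.-pker E ~> E) : set ('rV[R]_D -> R) :=
  [set f | exists g, is_generator Pt f g].

(* Such a [g] is unique; outside of the domain the value is arbitrary. *)
Definition generator (Pt : R -> R.-pker E ~> E) (f : 'rV[R]_D -> R) :
    'rV[R]_D -> R :=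
  xget (cst 0) [set g | is_generator Pt f g].

Section Kernel_action.
Variables (nu : probability E R) (k : R.-pker E ~> E).
Local Open Scope ereal_scope.

(* The measure nu P_t, for [k = Pt t] *)
Definition kernel_act (A : set E) : \bar R := \int[nu]_x k x A.

Let kernel_act0 : kernel_act set0 = 0.
Proof. by apply: integral0_eq => x _; rewrite measure0. Qed.

Let kernel_act_ge0 A : 0 <= kernel_act A.
Proof. by apply: integral_ge0 => x _; exact: measure_ge0. Qed.

Let kernel_act_sigma_additive : semi_sigma_additive kernel_act.
Proof.
move=> U mU tU mUU; rewrite [X in _ --> X](_ : _ =
  \int[nu]_y (\sum_(n <oo) k y (U n))); last first.
  apply: eq_integral => V _.
  by apply/esym/cvg_lim => //; exact/measure_semi_sigma_additive.
apply/cvg_closeP; split.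
  by apply: is_cvg_nneseries => n _ _; exact: integral_ge0.
rewrite closeE// integral_nneseries// => n.
exact: measurable_kernel k _ (mU n).
Qed.

HB.instance Definition _ := isMeasure.Build _ _ R kernel_act
  kernel_act0 kernel_act_ge0 kernel_act_sigma_additive.

Let kernel_act_setT : kernel_act [set: E] = 1.
Proof.
rewrite /kernel_act; under eq_integral do rewrite prob_kernel.
by rewrite integral_cst// mul1e; exact: probability_setT.
Qed.

HB.instance Definition _ :=
  Measure_isProbability.Build _ _ _ kernel_act kernel_act_setT.

End Kernel_action.

Definition semiflow (Pt : R -> R.-pker E ~> E) (nu : probability E R) (t : R) :
    probability E R :=
  kernel_act nu (Pt t).

End Processes.

(* Step sequences are indexed by [n >= 1]; their value at [0] is irrelevant. *)

Section Steps.
Context {R : realType}.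
Implicit Types (gamma eps : nat -> R).

Definition nonincreasing_to0 (u : nat -> R) :=
  (forall m n, (0 < m <= n)%N -> u n <= u m) /\ u n @[n --> \oo] --> (0 : R).

Definition tau gamma (n : nat) : R := \sum_(1 <= k < n.+1) gamma k.

(* The [n] in the set exists and is unique for [t >= 0] when the steps are
   positive with a divergent sum. *)
Definition step_index gamma (t : R) : nat :=
  xget 0%N [set n | tau gamma n <= t < tau gamma n.+1].

Definition rate gamma eps : \bar R :=
  (- limn_esup (fun n =>
       (ln (Num.max (gamma n) (eps n)) / tau gamma n)%:E))%E.

End Steps.

Section Chain.
Context {R : realType} {D : nat}.
Local Notation E := (borel R D).

(* L_n f (y), extended-real valued so that it makes sense for unbounded V >= 0 *)
Definition chain_generator (gamma : nat -> R) (K : nat -> R.-pker E ~> E)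
    (n : nat) (f : 'rV[R]_D -> R) (y : 'rV[R]_D) : \bar R :=
  ((gamma n.+1)^-1%:E * \int[K n y]_z (f z - f y)%:E)%E.

Definition law {d} {Omega : measurableType d} (P : probability Omega R)
    (X : {RV P >-> E}) : probability E R := distribution P X.

Definition interpolated_law {d} {Omega : measurableType d}
    (P : probability Omega R) (gamma : nat -> R) (y : nat -> {RV P >-> E})
    (t : R) : probability E R :=
  law (y (step_index gamma t)).

Definition class_dist (F : set ('rV[R]_D -> R)) (mu nu : probability E R) :
    \bar R :=
  ereal_sup [set `|\int[mu]_x (f x)%:E - \int[nu]_x (f x)%:E|%E | f in F].

Definition flow_gap (Phi : probability E R -> R -> probability E R)
    (d : probability E R -> probability E R -> \bar R)
    (mu : R -> probability E R) (T t : R) : \bar R :=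
  ereal_sup [set d (mu (t + s)) (Phi (mu t) s) | s in `[0, T]%classic].

Definition asymptotic_pseudotrajectory
    (Phi : probability E R -> R -> probability E R)
    (d : probability E R -> probability E R -> \bar R)
    (mu : R -> probability E R) :=
  forall T : R, 0 < T -> flow_gap Phi d mu T t @[t --> +oo] --> 0%E.

(* [lambda] may be +oo, in which case the limsup has to be -oo;
   [lne 0 = -oo]. *)
Definition lambda_pseudotrajectory (lambda : \bar R)
    (Phi : probability E R -> R -> probability E R)
    (d : probability E R -> probability E R -> \bar R)
    (mu : R -> probability E R) :=
  forall T : R, 0 < T ->
    (limf_esup (fun t : R => t^-1%:E * lne (flow_gap Phi d mu T t)) (pinfty_nbhs R)
      <= - lambda)%E.

Definition test_class (Pt : R -> R.-pker E ~> E) (N2 : multi_index D) :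
    set ('rV[R]_D -> R) :=
  [set f | [/\ generator_domain Pt f, class_Cb N2 f,
               generator_domain Pt (generator Pt f)
             & (supnorm (generator Pt f)
                + supnorm (generator Pt (generator Pt f))
                + Cnorm N2 f <= 1)%E]].

End Chain.

(* Main.v *)
Require Import Defs.
From HB Require Import structures.
From mathcomp Require Import all_boot all_order all_algebra.
From mathcomp Require Import all_classical all_reals all_analysis.
From mathcomp Require Import giry measurable_realfun ring lra.

(** The law of the chain is compared with the limit semigroup one move at a time.
Fix a test function [f] and grid times [tau n <= tau m]. With
[g = P_(tau m - tau k.+1) f],
[E f(y_m) - E (P_(tau m - tau n) f)(y_n)] is the sum over [n <= k < m] of
[E (g(y_k.+1)) - E (P_(gamma k.+1) g)(y_k)]. In such a term the chain moves [g] by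
[gamma k.+1 * L_k g], and the semigroup moves it by [gamma k.+1 * L g] up to
[gamma k.+1 ^ 2] times the sup norm of [L L g = P L L f], hence of [L L f]
([semigroup_taylor2]). The two generators are close by hypothesis: their difference
at [g] is at most a constant times [chi d1 * eps k], because the semigroup is
bounded from the [N2]-norm to the [N1]-norm, and the mean of [chi d1] along the
chain is bounded ([eventual_chi_bound]). Each term is therefore
[O(gamma k.+1 * max (gamma n) (eps n))] ([one_step_error]), and the steps
[gamma k.+1] add up to at most [T] plus one step ([telescoped_error]).

Off the grid, times are displaced by at most one step, which costs [O(gamma n)] by
the Lipschitz bound of the semigroup on its domain ([semigroup_lipschitz]).
Altogether the gap at time [t] is at most [C max (gamma n) (eps n)], where
[tau n <= t < tau n.+1] ([flow_gap_le]). Both conclusions follow: the right-hand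
side tends to 0, and its logarithm divided by [t] has the announced limsup because
[tau n] and [t] differ by a bounded amount.

The estimates on the semigroup are obtained by subdividing the time interval
rather than by integrating [P_s L f] in time, so that no measurability or continuity
in time enters: the uniform limit that defines the generator suffices. *)

Set Implicit Arguments.
Unset Strict Implicit.
Unset Printing Implicit Defensive.
Import Order.TTheory GRing.Theory Num.Theory.
Import numFieldNormedType.Exports.

Local Open Scope classical_set_scope.
Local Open Scope ring_scope.

(** * Laws after one move of a kernel *)

Section Mixtures.
Context {d d' : measure_display} {X : measurableType d} {Y : measurableType d'}
  {R : realType}.

(** The measure [k x] as a [probability]; the carrier is unchanged. *)
Definition kernel_prob (k : R.-pker X ~> Y) (x : X) : set Y -> \bar R := k x.

HB.instance Definition _ k x := Measure.on (kernel_prob k x).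
HB.instance Definition _ k x := Measure_isProbability.Build _ _ _
  (kernel_prob k x) (prob_kernel (s := k) x).

(** [rho] is the law after one move of the kernel [k] from the initial law [nu].
Stating this on measurable sets only lets the same change-of-order lemmas serve
the Chapman-Kolmogorov relation, the chain, and the semiflow. *)
Definition is_mixture (nu : probability X R) (k : R.-pker X ~> Y)
    (rho : probability Y R) :=
  forall A, measurable A -> rho A = (\int[nu]_x k x A)%E.

(** A mixture agrees on measurable sets with the bind of the Giry monad, for which
the exchange of integrals holds. *)
Lemma ge0_integral_mixture nu k rho (f : Y -> \bar R) : is_mixture nu k rho ->
    measurable_fun [set: Y] f -> (forall z, 0 <= f z)%E ->
  (\int[rho]_z f z = \int[nu]_x \int[k x]_z f z)%E.
Proof.
move=> rhoE mf f0.
have mk : measurable_fun [set: X] (kernel_prob k : X -> giry Y R).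
  by apply: measurable_giry_codensity => // B mB; exact: measurable_kernel.
have := giry_int_bind (nu : giry X R) mk mf f0.
rewrite /giry_int /= => <-; apply: eq_measure_integral => A mA _.
rewrite [LHS](rhoE A mA).
apply/esym; apply: (giry_int_map mk (nu : giry X R) (h := giry_ev ^~ A)) => //.
exact: measurable_giry_ev.
Qed.

End Mixtures.

(** * Bounded measurable functions *)

Section BoundedMeasurable.
Context {d : measure_display} {T : measurableType d} {R : realType}.
Implicit Types (f g : T -> R) (mu : {measure set T -> \bar R}).

(** These functions are integrable against every probability, and kernels map them
to functions of the same kind. On R^D they are the
[bounded_measurable] ones ([bounded_measurableP]). *)
Definition bounded_meas f :=
  measurable_fun [set: T] f /\ exists c, forall x, `|f x| <= c.

Lemma bounded_meas_cst c : bounded_meas (cst c).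
Proof. by split; [exact: measurable_cst|exists `|c|]. Qed.

Lemma bounded_measD f g : bounded_meas f -> bounded_meas g ->
  bounded_meas (fun x => f x + g x).
Proof.
move=> [mf [a fa]] [mg [b gb]]; split; first exact: measurable_funD.
by exists (a + b) => x; rewrite (le_trans (ler_normD _ _))// lerD.
Qed.

Lemma bounded_measZ c f : bounded_meas f -> bounded_meas (fun x => c * f x).
Proof.
move=> [mf [a fa]]; split; first exact: measurable_funM.
by exists (`|c| * a) => x; rewrite normrM ler_wpM2l.
Qed.

Lemma bounded_measB f g : bounded_meas f -> bounded_meas g ->
  bounded_meas (fun x => f x - g x).
Proof.
move=> bf bg.
under eq_fun do rewrite -mulN1r.
exact/bounded_measD/bounded_measZ.
Qed.

Lemma bounded_meas_integrable mu f : mu [set: T] = 1%E -> bounded_meas f ->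
  mu.-integrable [set: T] (EFin \o f).
Proof.
move=> mu1 [mf [c fc]]; apply: measurable_bounded_integrable => //.
  by rewrite mu1 ltry.
exists c; split; first exact: num_real.
by move=> a ca x _; apply: le_trans (fc x) (ltW ca).
Qed.

Lemma integral_cst1 mu (c : \bar R) : mu [set: T] = 1%E ->
  (\int[mu]_x c = c)%E.
Proof. by move=> mu1; rewrite integral_cst// mu1 mule1. Qed.

Lemma Rintegral_cst1 mu c : mu [set: T] = 1%E -> \int[mu]_x c = c.
Proof. by move=> mu1; rewrite Rintegral_cst// mu1 mulr1. Qed.

Lemma normr_Rintegral_le mu f c : mu [set: T] = 1%E -> bounded_meas f ->
  (forall x, `|f x| <= c) -> `|\int[mu]_x f x| <= c.
Proof.
move=> mu1 bf fc; have If := bounded_meas_integrable mu1 bf.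
apply: (le_trans (le_normr_Rintegral measurableT If)).
rewrite -[leRHS](Rintegral_cst1 c mu1); apply: le_Rintegral => //.
- exact: integrable_norm.
- exact/bounded_meas_integrable/bounded_meas_cst.
Qed.

End BoundedMeasurable.

Section BoundedMixtures.
Context {d d' : measure_display} {X : measurableType d} {Y : measurableType d'}
  {R : realType}.
Implicit Types (k : R.-pker X ~> Y) (f : Y -> R).

Lemma bounded_meas_kernel k f : bounded_meas f ->
  bounded_meas (fun x => \int[k x]_z f z).
Proof.
move=> bf; have [mf [c fc]] := bf; split; last first.
  by exists c => x; exact: (normr_Rintegral_le (prob_kernel x)).
(* Shifting [f] by its bound makes the integrand nonnegative, where measurability
   of the integral in the kernel parameter is available. *)
have -> : (fun x => \int[k x]_z f z) =
    (fun x => fine (\int[k x]_z (f z + c)%:E) - c).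
  apply/funext => x; rewrite -[X in X - _]/(\int[k x]_z (f z + c)).
  rewrite RintegralD//.
  - by rewrite Rintegral_cst1 ?prob_kernel// addrK.
  - exact: bounded_meas_integrable (prob_kernel x) bf.
  - exact: bounded_meas_integrable (prob_kernel x) (bounded_meas_cst c).
apply: measurable_funB => //.
apply: (measurableT_comp (fine_measurable measurableT)).
apply: measurable_fun_integral_kernel => //.
- exact: measurable_kernel.
- move=> z; rewrite lee_fin -lerBlDr sub0r.
  by have := fc z; rewrite ler_norml => /andP[].
- by apply/measurable_EFinP; exact: measurable_funD.
Qed.

(** The shift of [f] by a bound [c] makes it nonnegative and changes both sides by
the same [c], since all measures here have mass 1. *)
Lemma Rintegral_mixture nu k rho f : is_mixture nu k rho -> bounded_meas f ->
  \int[rho]_z f z = \int[nu]_x \int[k x]_z f z.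
Proof.
move=> rhoE bf; have [mf [c fc]] := bf.
have bc := bounded_meas_cst c.
have Ik x := bounded_meas_integrable (prob_kernel (s := k) x) bf.
have bkf := bounded_meas_kernel k bf.
apply: (@addIr _ c).
rewrite -[X in _ + X = _](Rintegral_cst1 c (probability_setT rho)).
rewrite -[X in _ = _ + X](Rintegral_cst1 c (probability_setT nu)).
rewrite -!RintegralD//.
- rewrite /Rintegral (ge0_integral_mixture rhoE).
  + congr fine; apply: eq_integral => x _.
    rewrite -[in RHS](Rintegral_cst1 c (prob_kernel (s := k) x)).
    rewrite -[in RHS]RintegralD//.
      rewrite /Rintegral fineK//; apply: integrable_fin_num => //.
      by apply: bounded_meas_integrable (prob_kernel x) _; exact: bounded_measD.
    exact: bounded_meas_integrable (prob_kernel x) (bounded_meas_cst c).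
  + by apply/measurable_EFinP; exact: measurable_funD.
  + move=> z; rewrite lee_fin -lerBlDr sub0r.
    by have := fc z; rewrite ler_norml => /andP[].
all: apply: bounded_meas_integrable => //; exact: probability_setT.
Qed.

End BoundedMixtures.

(** * The support carries the measure *)

Section Support.
Context {R : realType} {D : nat}.

Lemma measurable_borel_open (U : set 'rV[R]_D) : open U ->
  measurable (U : set (borel R D)).
Proof. by move=> oU; exact: sub_sigma_algebra. Qed.

Lemma rat_dense_rV (x : 'rV[R]_D) (e : R) : 0 < e ->
  exists q : 'rV[rat]_D, ball x e (map_mx ratr q : 'rV[R]_D).
Proof.
move=> e0.
have /choice[q qx] : forall j, exists q : rat, `|x ord0 j - ratr q| < e.
  move=> j; have /rat_in_itvoo[q] : x ord0 j - e < x ord0 j + e by lra.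
  by rewrite in_itv/= => /andP[? ?]; exists q; rewrite ltr_norml; lra.
exists (\row_j q j); split => // i j.
by rewrite !mxE (ord1 i); exact: qx.
Qed.

(** The complement of the support is covered by the null balls with rational centre
and radius [1 / n.+1], of which there are countably many. This is what turns the
hypotheses on the support of the chain into almost sure ones. *)
Lemma ae_msupport (mu : probability (borel R D) R) :
  {ae mu, forall z, msupport mu z}.
Proof.
pose B (p : 'rV[rat]_D * nat) : set 'rV[R]_D :=
  ball (map_mx ratr p.1 : 'rV[R]_D) p.2.+1%:R^-1.
pose F n : set (borel R D) := if unpickle n is Some p then
  if mu (B p) == 0%E then B p else set0 else set0.
have F0 n : mu.-negligible (F n).
  rewrite /F; case: unpickle => [p|]; last exact: negligible_set0.
  case: eqP => [p0|_]; last exact: negligible_set0.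
  exists (B p); split => //; apply: measurable_borel_open; rewrite /B; apply: ball_open.
apply: negligibleS (negligible_bigcup F0) => x /=.
move=> /existsNP[U /not_implyP[oU /not_implyP[Ux /negP]]].
rewrite -leNgt => U0.
have /nbhs_ballP[e /= e0 eU] : nbhs x U by exact: open_nbhs_nbhs.
have [n] := ltr_add_invr (divr_gt0 e0 (ltr0n R 2)); rewrite add0r => ne.
have n0 : 0 < n.+1%:R^-1 :> R by rewrite invr_gt0 ltr0n.
have [q xq] := rat_dense_rV x n0.
(* [n] was taken with [1 / n.+1 < e / 2]: the ball around [q] contains [x] and stays
   within [e] of it. *)
have qU : B (q, n) `<=` U.
  move=> z qz; apply: eU; rewrite [e]splitr.
  by apply: ball_triangle (le_ball (ltW ne) xq) (le_ball (ltW ne) qz).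
have Bq0 : mu (B (q, n)) = 0%E.
  apply/eqP; rewrite eq_le measure_ge0 andbT (le_trans _ U0)//.
  by apply: le_measure => //; rewrite inE;
    apply: measurable_borel_open => //; exact: ball_open.
exists (pickle (q, n)) => //; rewrite /F pickleK.
by rewrite Bq0 eqxx; exact: ball_sym.
Qed.

End Support.

(** * Semigroup and generator *)

Section SupNorm.
Context {R : realType} {D : nat}.
Implicit Types f g : 'rV[R]_D -> R.

Lemma supnorm_leP f c : (supnorm f <= c%:E)%E <-> forall x, `|f x| <= c.
Proof.
split=> [fc x|fc].
  by rewrite -lee_fin (le_trans _ fc)//; apply: ereal_sup_ubound; exists x.
by apply: ge_ereal_sup => _ [x _ <-]; rewrite lee_fin.
Qed.

Lemma le_supnorm f x : (`|f x|%:E <= supnorm f)%E.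
Proof. by apply: ereal_sup_ubound; exists x. Qed.

Lemma supnorm_ge0 f : (0 <= supnorm f)%E.
Proof. by apply: le_trans (le_supnorm f 0); rewrite lee_fin. Qed.

Lemma bounded_measurableP f :
  bounded_measurable f <-> bounded_meas (f : borel R D -> R).
Proof.
split=> [[mf fy]|[mf [c fc]]]; split=> //.
  exists (fine (supnorm f)); apply/supnorm_leP.
  by rewrite fineK// ge0_fin_numE// supnorm_ge0.
by rewrite (le_lt_trans ((supnorm_leP f c).2 fc))// ltry.
Qed.

End SupNorm.

Section SemigroupTheory.
Context {R : realType} {D : nat}.
Local Notation E := (borel R D).
Variable Pt : R -> R.-pker E ~> E.
Implicit Types (f g w : 'rV[R]_D -> R) (s t c : R).
Local Notation bm := (bounded_meas (T := E)).

Definition chapman_kolmogorov := forall s t x, 0 <= s -> 0 <= t ->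
  is_mixture (kernel_prob (Pt s) x) (Pt t) (kernel_prob (Pt (s + t)) x).

Definition starts_at_identity := forall f x, bm f -> semigroup Pt 0 f x = f x.

Hypothesis ck : chapman_kolmogorov.
Hypothesis P0 : starts_at_identity.

Lemma semigroup_bounded t f : bm f -> bm (semigroup Pt t f).
Proof. exact: bounded_meas_kernel. Qed.

Lemma semigroup_le t f c x : bm f -> (forall z, `|f z| <= c) ->
  `|semigroup Pt t f x| <= c.
Proof. by move=> bf; exact: normr_Rintegral_le (prob_kernel (s := Pt t) x) bf. Qed.

Lemma semigroupB t f g x : bm f -> bm g ->
  semigroup Pt t (fun z => f z - g z) x = semigroup Pt t f x - semigroup Pt t g x.
Proof.
move=> bf bg; rewrite /semigroup RintegralB//;
  exact: bounded_meas_integrable (prob_kernel (s := Pt t) x) _.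
Qed.

Lemma semigroupZ t c f x : bm f ->
  semigroup Pt t (fun z => c * f z) x = c * semigroup Pt t f x.
Proof.
move=> bf; rewrite /semigroup RintegralZl//.
exact: bounded_meas_integrable (prob_kernel (s := Pt t) x) _.
Qed.

Lemma semigroupD s t f x : 0 <= s -> 0 <= t -> bm f ->
  semigroup Pt (s + t) f x = semigroup Pt s (semigroup Pt t f) x.
Proof. by move=> s0 t0 bf; exact: Rintegral_mixture (ck x s0 t0) bf. Qed.

(** The uniform limit defining the generator, multiplied out by [h]: this form can
be summed over the pieces of a subdivision. *)
Lemma is_generator_near f g e : is_generator Pt f g -> 0 < e ->
  exists2 h0, 0 < h0 &
    forall h x, 0 < h < h0 -> `|semigroup Pt h f x - f x - h * g x| <= h * e.
Proof.
move=> [_ _ fg] e0.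
have : \forall h \near (0 : R)^'+,
    (supnorm (fun x => h^-1 * (semigroup Pt h f x - f x) - g x)%R < e%:E)%E.
  by apply: (fg [set u | (u < e%:E)%E]); apply: open_ereal_lt'; rewrite lte_fin.
rewrite near_withinE => /nbhs_ballP[h0 /= h00 h0e]; exists h0 => // h x /andP[hp hh].
have /(_ _ hp)/ltW/supnorm_leP/(_ x) := h0e h.
rewrite /ball/= sub0r normrN gtr0_norm// => /(_ hh) hx.
have -> : semigroup Pt h f x - f x - h * g x =
    h * (h^-1 * (semigroup Pt h f x - f x) - g x).
  by rewrite mulrBr mulrA divff ?gt_eqF// mul1r.
by rewrite normrM gtr0_norm// ler_pM2l.
Qed.

Lemma is_generator_unique f g1 g2 : is_generator Pt f g1 -> is_generator Pt f g2 ->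
  g1 = g2.
Proof.
move=> fg1 fg2; apply/funext => x; apply/eqP; rewrite -subr_eq0 -normr_le0.
apply/ler_addgt0Pl => e e0; rewrite addr0.
have e2 : 0 < e / 2 by rewrite divr_gt0.
have [h1 h10 H1] := is_generator_near fg1 e2.
have [h2 h20 H2] := is_generator_near fg2 e2.
pose h := Num.min h1 h2 / 2.
have h0 : 0 < h by rewrite divr_gt0// lt_min h10.
have hlt : h < Num.min h1 h2 by rewrite ltr_pdivrMr// ltr_pMr ?ltr1n// lt_min h10.
move: hlt; rewrite lt_min => /andP[hh1 hh2].
have {}H1 := H1 h x; have {}H2 := H2 h x.
rewrite h0 hh1 in H1; rewrite h0 hh2 in H2.
rewrite -(ler_pM2l h0) -[X in X * `|_|]gtr0_norm// -normrM.
have -> : h * (g1 x - g2 x) = (semigroup Pt h f x - f x - h * g2 x) -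
  (semigroup Pt h f x - f x - h * g1 x) by ring.
rewrite (le_trans (ler_normB _ _))// [in leRHS](splitr e) mulrDr.
by rewrite lerD ?H1 ?H2.
Qed.

Lemma generator_spec f : generator_domain Pt f -> is_generator Pt f (generator Pt f).
Proof. by move=> df; rewrite /generator; exact: (xgetPex (cst 0) df). Qed.

Lemma generatorE f g : is_generator Pt f g -> generator Pt f = g.
Proof.
by move=> fg; apply: (is_generator_unique _ fg); apply: generator_spec; exists g.
Qed.

Lemma is_generator_cst0 : is_generator Pt (cst 0) (cst 0).
Proof.
have b0 : bounded_measurable (cst 0 : 'rV[R]_D -> R).
  exact/bounded_measurableP/bounded_meas_cst.
split=> //.
have -> : (fun t => supnorm (fun x => t^-1 *
    (semigroup Pt t (cst 0) x - cst (0:R) x) - cst (0:R) x)) = cst 0%E.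
  apply/funext => t; apply/eqP; rewrite eq_le supnorm_ge0 andbT.
  apply/supnorm_leP => x.
  by rewrite /semigroup Rintegral_cst1 ?prob_kernel//= !subr0 mulr0 normr0.
exact: cvg_cst.
Qed.

(** [P_t] commutes with the difference quotients of [P_h] and contracts the sup
norm, so it carries the domain into itself and commutes with the generator. *)
Lemma is_generator_semigroup f g t : is_generator Pt f g -> 0 <= t ->
  is_generator Pt (semigroup Pt t f) (semigroup Pt t g).
Proof.
move=> [/bounded_measurableP bf /bounded_measurableP bg fg] t0.
split; [exact/bounded_measurableP/semigroup_bounded|
        exact/bounded_measurableP/semigroup_bounded|].
apply: squeeze_cvge (cvg_cst 0%E) fg.
near=> h; rewrite supnorm_ge0/=.
have h0 : 0 < h by near: h; exact: nbhs_right_gt.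
apply: ge_ereal_sup => _ [x _ <-].
set u := fun x => h^-1 * (semigroup Pt h f x - f x) - g x.
have bhf := semigroup_bounded h bf.
have bu : bm (fun x => h^-1 * (semigroup Pt h f x - f x)).
  exact/bounded_measZ/bounded_measB.
have -> : h^-1 * (semigroup Pt h (semigroup Pt t f) x - semigroup Pt t f x) -
    semigroup Pt t g x = semigroup Pt t u x.
  rewrite semigroupB// semigroupZ; last exact: bounded_measB.
  have h0' := ltW h0.
  by rewrite semigroupB// -!semigroupD// (addrC h).
have /bounded_measurableP[_ uy] : bm u by exact: bounded_measB.
rewrite -[leRHS]fineK ?ge0_fin_numE ?supnorm_ge0// lee_fin.
apply: semigroup_le; first exact: bounded_measB.
by apply/supnorm_leP; rewrite fineK// ge0_fin_numE// supnorm_ge0.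
Unshelve. all: by end_near. Qed.

End SemigroupTheory.

(** * Taylor estimates for the semigroup *)

Section TaylorEstimates.
Context {R : realType} {D : nat}.
Local Notation E := (borel R D).
Variable Pt : R -> R.-pker E ~> E.
Implicit Types (f g w : 'rV[R]_D -> R) (s t c : R).
Local Notation bm := (bounded_meas (T := E)).
Hypothesis ck : chapman_kolmogorov Pt.
Hypothesis P0 : starts_at_identity Pt.

Lemma is_generator_bounded f g : is_generator Pt f g -> bm f /\ bm g.
Proof. by move=> [/bounded_measurableP bf /bounded_measurableP bg _]. Qed.

(** A step [t / n] fine enough for [is_generator_near] to apply on each piece. *)
Lemma subdivide t h0 : 0 < t -> 0 < h0 ->
  exists n, [/\ (0 < n)%N, 0 < t / n%:R < h0 & n%:R * (t / n%:R) = t].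
Proof.
move=> t0 h00; have [k] := ltr_add_invr (divr_gt0 h00 t0).
rewrite add0r => kh; exists k.+1.
have k0 : 0 < k.+1%:R :> R by rewrite ltr0n.
split => //; last by rewrite mulrCA divff ?mulr1// gt_eqF.
by rewrite divr_gt0//= mulrC -ltr_pdivlMr.
Qed.

(** Cut [0, t] into pieces of length [h]: on each of them [P_h f - f] is
[h L f + o(h)] and the remaining semigroup contracts, so the increments add up to
[t (sup |L f| + o(1))]. This replaces the integral formula
[P_t f - f = int_0^t P_s L f ds] and needs no regularity of [s |-> P_s L f]. *)
Lemma semigroup_lipschitz0 f g c t x : is_generator Pt f g ->
  (forall z, `|g z| <= c) -> 0 <= t ->
  `|semigroup Pt t f x - f x| <= t * c.
Proof.
move=> fg gc; rewrite le_eqVlt => /predU1P[<-|t0].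
  by rewrite P0 ?subrr ?normr0 ?mul0r//; case: (is_generator_bounded fg).
have [bf bg] := is_generator_bounded fg.
apply/ler_addgt0Pr => e e0.
have [h0 h00 H] := is_generator_near fg (divr_gt0 e0 t0).
have [n [n0 hh nh]] := subdivide t0 h00.
set h := t / n%:R in hh nh; have /andP[hp hh0] := hh.
have step z : `|semigroup Pt h f z - f z| <= h * (c + e / t).
  have -> : semigroup Pt h f z - f z =
    (semigroup Pt h f z - f z - h * g z) + h * g z by ring.
  rewrite (le_trans (ler_normD _ _))// mulrDr addrC lerD ?H//.
  by rewrite normrM gtr0_norm// ler_wpM2l// ltW.
have iter k z : `|semigroup Pt (k%:R * h) f z - f z| <= k%:R * h * (c + e / t).
  elim: k z => [|k IH] z; first by rewrite !mul0r P0// subrr normr0.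
  have kh0 : 0 <= k%:R * h by rewrite mulr_ge0// ltW.
  rewrite -natr1 mulrDl mul1r semigroupD ?(ltW hp)//.
  have -> : semigroup Pt (k%:R * h) (semigroup Pt h f) z - f z =
      semigroup Pt (k%:R * h) (fun z => semigroup Pt h f z - f z) z +
      (semigroup Pt (k%:R * h) f z - f z).
    by rewrite semigroupB//; [ring|exact: semigroup_bounded].
  rewrite (le_trans (ler_normD _ _))// mulrDl [leRHS]addrC lerD//.
  by apply: semigroup_le => //; apply: bounded_measB => //; exact: semigroup_bounded.
have := iter n x; rewrite nh mulrDr mulrCA divff ?gt_eqF// mulr1//.
Qed.

(** Second-order version by the same subdivision: replacing [P_s L f] by [L f] on
the piece starting at [s] costs [s sup |L L f|] by [semigroup_lipschitz0], and
[s <= t]. Bounding [s] by [t] on every piece gives the constant 1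
instead of the sharp 1/2. *)
Lemma semigroup_taylor2 f g w c t x : is_generator Pt f g ->
  is_generator Pt g w -> (forall z, `|w z| <= c) -> 0 <= t ->
  `|semigroup Pt t f x - f x - t * g x| <= t ^+ 2 * c.
Proof.
move=> fg gw wc; rewrite le_eqVlt => /predU1P[<-|t0].
  rewrite P0; last by case: (is_generator_bounded fg).
  by rewrite subrr !mul0r expr0n/= mul0r subr0 normr0.
have c0 : 0 <= c by exact: le_trans (wc 0).
have [bf bg] := is_generator_bounded fg; have [_ bw] := is_generator_bounded gw.
apply/ler_addgt0Pr => e e0.
have [h0 h00 H] := is_generator_near fg (divr_gt0 e0 t0).
have [n [n0 hh nh]] := subdivide t0 h00.
set h := t / n%:R in hh nh; have /andP[hp hh0] := hh.
pose u z := semigroup Pt h f z - f z - h * g z.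
have bhf : bm (semigroup Pt h f) by exact: semigroup_bounded.
have bhg : bm (fun z => h * g z) by exact: bounded_measZ.
have bu : bm u by apply: bounded_measB => //; exact: bounded_measB.
have iter k z : (k <= n)%N ->
    `|semigroup Pt (k%:R * h) f z - f z - k%:R * h * g z| <=
    k%:R * h * (t * c + e / t).
  elim: k z => [|k IH] z kn; first by rewrite !mul0r P0// subrr subr0 normr0.
  have kh0 : 0 <= k%:R * h by rewrite mulr_ge0// ltW.
  have kht : k%:R * h <= t by rewrite -nh ler_wpM2r ?ltW// ltr_nat.
  rewrite -natr1 !mulrDl !mul1r semigroupD ?(ltW hp)//.
  have -> : semigroup Pt (k%:R * h) (semigroup Pt h f) z - f z -
        (k%:R * h * g z + h * g z) =
      (semigroup Pt (k%:R * h) f z - f z - k%:R * h * g z) +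
      (h * (semigroup Pt (k%:R * h) g z - g z) + semigroup Pt (k%:R * h) u z).
    rewrite semigroupB//; last exact: bounded_measB.
    by rewrite semigroupB// semigroupZ//; ring.
  rewrite (le_trans (ler_normD _ _))// lerD ?IH ?(ltnW kn)//.
  rewrite (le_trans (ler_normD _ _))// [leRHS]mulrDr lerD//.
    rewrite normrM (gtr0_norm hp) ler_wpM2l ?(ltW hp)//.
    by rewrite (le_trans (semigroup_lipschitz0 z gw wc kh0))// ler_wpM2r.
  by apply: semigroup_le => // y; exact: H.
have := iter n x (leqnn n).
by rewrite nh mulrDr mulrA -expr2 mulrCA divff ?gt_eqF// mulr1.
Qed.

Lemma semigroup_lipschitz f g c s t x : is_generator Pt f g ->
  (forall z, `|g z| <= c) -> 0 <= s -> 0 <= t ->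
  `|semigroup Pt s f x - semigroup Pt t f x| <= `|s - t| * c.
Proof.
wlog st : s t / s <= t.
  move=> H fg gc s0 t0; have [st|/ltW ts] := leP s t; first exact: H.
  by rewrite distrC (distrC s); exact: H.
move=> fg gc s0 t0; have [bf bg] := is_generator_bounded fg.
have ts0 : 0 <= t - s by rewrite subr_ge0.
rewrite distrC (distrC s) [`|t - s|]ger0_norm//.
rewrite -{1}(subrKC s t) semigroupD// -semigroupB//; last exact: semigroup_bounded.
apply: semigroup_le => [|z]; last exact: semigroup_lipschitz0 fg gc ts0.
by apply: bounded_measB => //; exact: semigroup_bounded.
Qed.

End TaylorEstimates.

(** * Kernels of the processes and polynomial weights *)

Section ProcessKernels.
Context {R : realType} {D : nat}.
Local Notation E := (borel R D).

(** The whole space belongs to every past; on it the Markov property becomes a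
relation between laws. *)
Lemma sigma_ofT {d} {Omega : measurableType d} {I : Type}
    (X : I -> Omega -> E) (J : set I) : sigma_of X J [set: Omega].
Proof. by rewrite -setC0; apply: sigma_algebraC; exact: sigma_algebra0. Qed.

Lemma markov_chain_mixture {d} {Omega : measurableType d}
    (P : probability Omega R) (K : nat -> R.-pker E ~> E)
    (y : nat -> {RV P >-> E}) n : markov_chain K y ->
  is_mixture (law (y n)) (K n) (law (y n.+1)).
Proof.
move=> Hy A mA.
have := Hy n setT A (@sigma_ofT _ _ _ _ _) mA; rewrite setTI => yA.
rewrite [LHS]yA ge0_integral_distribution//; exact: measurable_kernel.
Qed.

Lemma semiflow_mixture (nu : probability E R) (Pt : R -> R.-pker E ~> E) t :
  is_mixture nu (Pt t) (semiflow Pt nu t).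
Proof. by []. Qed.

Context {dX : measure_display} {Omega : measurableType dX}.
Variables (Pt : R -> R.-pker E ~> E) (Q : E -> probability Omega R)
  (X : R -> {mfun Omega >-> E}).
Hypothesis HX : homogeneous_markov_process Pt Q X.

(** The Markov property integrated over all trajectories, with the law of [X s]
under [Q x] recognised as [Pt s x]. *)
Lemma markov_process_ck : chapman_kolmogorov Pt.
Proof.
move=> s t x s0 t0 A mA.
have [_ HPt Hm _] := HX.
have := Hm x s t setT A s0 t0 (@sigma_ofT _ _ _ _ _) mA; rewrite setTI => XA.
rewrite [LHS]HPt ?addr_ge0// XA.
rewrite -[LHS](ge0_integral_distribution (P := Q x) (X s) (f := fun z => Pt t z A))//.
  by apply: eq_measure_integral => B mB _; rewrite [RHS]HPt.
exact: measurable_kernel.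
Qed.

Lemma markov_process_id : starts_at_identity Pt.
Proof.
move=> f x bf; have [X0 HPt _ _] := HX.
rewrite /semigroup /Rintegral.
have If := bounded_meas_integrable (probability_setT (Q x)) (_ : bounded_meas (f \o X 0)).
have bfX : bounded_meas (f \o X 0 : Omega -> R).
  case: bf => mf [c fc]; split; first exact: measurableT_comp.
  by exists c => w; exact: fc.
transitivity (fine (\int[distribution (Q x) (X 0)]_z (f z)%:E)).
  by congr fine; apply: eq_measure_integral => B mB _; rewrite HPt.
rewrite integral_distribution//; last 2 first.
- by apply/measurable_EFinP; case: bf.
- exact: If.
rewrite (ae_eq_integral (cst (f x)%:E))//.
- by rewrite integral_cst// [X in (_ * X)%E]probability_setT mule1.
- by apply/measurable_EFinP; case: bfX.
- by apply: filterS (X0 x) => w /= -> _.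
Qed.

End ProcessKernels.

Section Weights.
Context {R : realType} {D : nat}.
Local Notation E := (borel R D).
Implicit Types (N : multi_index D).

Lemma measurable_coord (i : 'I_D) :
  measurable_fun [set: E] (fun z : E => (z : 'rV[R]_D) ord0 i).
Proof.
apply: (measurability _ (RGenOpens.measurableE R)).
move=> _ [_ [a [b ->] <-]]; rewrite setTI; apply: measurable_borel_open.
have /continuousP := @coord_continuous R 1 D ord0 i.
by apply; exact: interval_open.
Qed.

Lemma measurable_chi N : measurable_fun [set: E] (chi N : E -> R).
Proof.
apply: measurable_sum => i; apply: measurable_sum => k.
by apply: measurable_funX; apply: measurableT_comp => //; exact: measurable_coord.
Qed.

Lemma chi_ge0 N (z : 'rV[R]_D) : 0 <= chi N z.
Proof. by apply: sumr_ge0 => i _; apply: sumr_ge0 => k _; exact: exprn_ge0. Qed.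

Lemma chi_le N1 N2 (z : 'rV[R]_D) : mi_le N1 N2 -> chi N1 z <= chi N2 z.
Proof.
move=> N12; apply: ler_sum => i _.
rewrite [leRHS](big_cat_nat (n := (N1 i).+1))//=; last by rewrite ltnS; exact: N12.
by rewrite lerDl sumr_ge0// => k _; exact: exprn_ge0.
Qed.

(** A Lyapunov function dominates [chi N] only outside a ball; inside, each
coordinate is bounded by the radius. *)
Lemma chi_bounded_on_ball N (a : R) : exists2 c, 0 <= c &
  forall z : 'rV[R]_D, euclidean_norm z <= a -> chi N z <= c.
Proof.
exists (\sum_(i < D) \sum_(0 <= k < (N i).+1) `|a| ^+ k).
  by apply: sumr_ge0 => i _; apply: sumr_ge0 => k _; exact: exprn_ge0.
move=> z za; apply: ler_sum => i _; apply: ler_sum => k _; apply: lerXn2r.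
- exact: normr_ge0.
- exact: normr_ge0.
rewrite (le_trans _ (ler_norm a))//.
rewrite (le_trans _ za)// -sqrtr_sqr /euclidean_norm ler_wsqrtr//.
rewrite (bigD1 i)//= lerDl sumr_ge0// => j _; exact: sqr_ge0.
Qed.

End Weights.

(** * One step of the chain *)

Section OneStep.
Context {R : realType} {D : nat}.
Local Notation E := (borel R D).
Variable Pt : R -> R.-pker E ~> E.
Hypothesis ck : chapman_kolmogorov Pt.
Hypothesis P0 : starts_at_identity Pt.

(** One move of the chain against one move of the limit semigroup over the same
time. The chain gives [g + gam L_n g] exactly and the semigroup gives
[g + gam L g] up to [gam^2 sup |L L g|]; the two generators differ by at most
[A W], whose mean is controlled by [M]. *)
Lemma one_step_error (nu rho : probability E R) (k : R.-pker E ~> E)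
    (g g1 g2 W : 'rV[R]_D -> R) (gam A M c : R) :
  is_mixture nu k rho -> is_generator Pt g g1 -> is_generator Pt g1 g2 ->
  (forall z, `|g2 z| <= c) -> 0 < gam -> 0 <= A ->
  measurable_fun [set: E] (W : E -> R) -> (forall z, 0 <= W z) ->
  (\int[nu]_z (W z)%:E <= M%:E)%E ->
  {ae nu, forall z, `|g1 z - gam^-1 * (\int[k z]_u g u - g z)| <= A * W z} ->
  `|\int[rho]_z g z - \int[nu]_z semigroup Pt gam g z| <= gam * (A * M + gam * c).
Proof.
move=> rhoE gg1 g12 g2c gam0 A0 mW W0 WM Hae.
have [bg bg1] := is_generator_bounded gg1.
have bkg : bounded_meas (fun z : E => \int[k z]_u g u) by exact: bounded_meas_kernel.
have bPg : bounded_meas (semigroup Pt gam g : E -> R) by exact: semigroup_bounded.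
have c0 : 0 <= c by exact: le_trans (g2c 0).
have nu1 := probability_setT nu.
rewrite (Rintegral_mixture rhoE bg) -RintegralB//; last 2 first.
- exact: bounded_meas_integrable.
- exact: bounded_meas_integrable.
have bh := bounded_measB bkg bPg.
have Ih := bounded_meas_integrable nu1 bh.
rewrite -lee_fin (EFin_normr_Rintegral measurableT Ih).
apply: (le_trans (le_abse_integral nu measurableT (measurable_int _ Ih))).
have mb : measurable_fun [set: E] (fun z : E => gam * (A * W z) + gam * (gam * c)).
  by apply: measurable_funD => //; do 2 apply: measurable_funM => //.
apply: (@le_trans _ _ (\int[nu]_z (gam * (A * W z) + gam * (gam * c))%:E)%E).
  apply: ae_ge0_le_integral => //.
  - by do 2 apply: measurableT_comp => //; case: bh.
  - by move=> z _; rewrite lee_fin addr_ge0 ?mulr_ge0// ltW.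
  - exact/measurable_EFinP.
  apply: (@filterS _ _ (ae_filter_ringOfSetsType nu) _ _ _ Hae) => z Hz _.
  rewrite /= lee_fin.
  have -> : \int[k z]_u g u - semigroup Pt gam g z =
      - (gam * (g1 z - gam^-1 * (\int[k z]_u g u - g z))) -
      (semigroup Pt gam g z - g z - gam * g1 z).
    by rewrite mulrBr mulrA divff ?gt_eqF// mul1r; ring.
  rewrite (le_trans (ler_normB _ _))// lerD//.
    by rewrite normrN normrM gtr0_norm// ler_pM2l.
  rewrite mulrA -expr2; apply: (semigroup_taylor2 ck P0) gg1 g12 g2c (ltW gam0).
under eq_integral do rewrite EFinD mulrA EFinM.
rewrite ge0_integralD//; last 3 first.
- by move=> z _; rewrite -EFinM lee_fin !mulr_ge0// ltW.
- by apply: measurable_funeM; exact/measurable_EFinP.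
- by move=> z _; rewrite lee_fin !mulr_ge0// ltW.
rewrite ge0_integralZl//; last 3 first.
- exact/measurable_EFinP.
- by move=> z _; rewrite lee_fin.
- by rewrite lee_fin mulr_ge0// ltW.
rewrite integral_cst1// mulrDr EFinD leeD2r//.
by rewrite mulrA [leRHS]EFinM lee_wpmul2l// lee_fin mulr_ge0// ltW.
Qed.

End OneStep.

Section Moments.
Context {R : realType} {D : nat}.
Local Notation E := (borel R D).

(** The integral of [V u - V z] makes sense because its negative part is at most
[V z]; adding that finite part back on both sides gives the bound on the integral
of [V], which is thereby finite. *)
Lemma kernel_drift (k : R.-pker E ~> E) (V : 'rV[R]_D -> R) z (r : R) :
  measurable_fun [set: E] (V : E -> R) -> (forall u, 0 <= V u) ->
  (\int[k z]_u (V u - V z)%:E <= r%:E)%E ->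
  (\int[k z]_u (V u)%:E <= (V z + r)%:E)%E.
Proof.
move=> mV V0; pose h (u : E) := (V u - V z)%:E.
have mh : measurable_fun setT h by apply/measurable_EFinP; exact: measurable_funB.
rewrite -/(integral _ _ h) integralE.
have mhp : measurable_fun setT (h^\+)%E by exact: measurable_funepos.
have mhn : measurable_fun setT (h^\-)%E by exact: measurable_funeneg.
have hnV : (\int[k z]_u (h^\-)%E u <= (V z)%:E)%E.
  apply: (@le_trans _ _ (\int[k z]_u (cst (V z)%:E) u)%E).
    apply: ge0_le_integral => //.
    by move=> u _; rewrite funenegE /h /= ge_max !lee_fin V0 andbT; have := V0 u; lra.
  by rewrite integral_cst1// prob_kernel.
have hn0 : (0 <= \int[k z]_u (h^\-)%E u)%E by exact: integral_ge0.
have hnfin : (\int[k z]_u (h^\-)%E u)%E \is a fin_num.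
  by rewrite ge0_fin_numE// (le_lt_trans hnV)// ltry.
have key : (\int[k z]_u (V u)%:E + \int[k z]_u (h^\-)%E u =
    \int[k z]_u (h^\+)%E u + (V z)%:E)%E.
  rewrite -[X in (_ + X)%E = _]/(\int[k z]_u (h^\-)%E u)%E.
  rewrite -ge0_integralD//; last 2 first.
  - by move=> u _; rewrite lee_fin.
  - exact/measurable_EFinP.
  rewrite -[X in _ = (_ + X)%E](integral_cst1 _ (prob_kernel (s := k) z)).
  rewrite -ge0_integralD//; last by move=> u _; rewrite lee_fin.
  apply: eq_integral => u _; rewrite funeposE funenegE /h /= -!EFin_max -!EFinD.
  by congr EFin; rewrite /Num.max; case: ifPn; case: ifPn; rewrite -?leNgt; lra.
rewrite leeBlDr// => hp.
rewrite -(leeD2rE _ _ hnfin) key addeC EFinD -addeA leeD2l//.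
Qed.

(** [kernel_drift] integrated over [nu]; since [gam * al <= 1], the coefficient of
[V z] is nonnegative, so that a bound on the mean of [V] may be inserted. *)
Lemma moment_drift (nu rho : probability E R) (k : R.-pker E ~> E)
    (V : 'rV[R]_D -> R) (gam al be m : R) :
  is_mixture nu k rho -> measurable_fun [set: E] (V : E -> R) ->
  (forall z, 0 <= V z) -> 0 < gam -> 0 <= be -> gam * al <= 1 ->
  {ae nu, forall z,
    (gam^-1%:E * \int[k z]_u (V u - V z)%:E <= (- al * V z + be)%:E)%E} ->
  (\int[nu]_z (V z)%:E <= m%:E)%E ->
  (\int[rho]_z (V z)%:E <= ((1 - gam * al) * m + gam * be)%:E)%E.
Proof.
move=> rhoE mV V0 gam0 be0 gal Hae Vm.
have g1 : 0 <= 1 - gam * al by rewrite subr_ge0.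
rewrite (ge0_integral_mixture rhoE)//; last first.
  exact/measurable_EFinP.
apply: (@le_trans _ _ (\int[nu]_z ((1 - gam * al)%:E * (V z)%:E + (gam * be)%:E))%E).
  apply: ae_ge0_le_integral => //.
  - by move=> z _; apply: integral_ge0 => u _; rewrite lee_fin.
  - apply: measurable_fun_integral_kernel => //.
    + exact: measurable_kernel.
    + exact/measurable_EFinP.
  - by move=> z _; rewrite -EFinM -EFinD lee_fin addr_ge0// mulr_ge0// ltW.
  - apply: emeasurable_funD => //; apply: measurable_funeM; exact/measurable_EFinP.
  apply: (@filterS _ _ (ae_filter_ringOfSetsType nu) _ _ _ Hae) => z Hz _.
  rewrite -EFinM -EFinD.
  have -> : (1 - gam * al) * V z + gam * be = V z + gam * (- al * V z + be) by ring.
  apply: kernel_drift => //.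
  by rewrite EFinM -lee_pdivrMl.
rewrite ge0_integralD//; last 3 first.
- by move=> z _; rewrite -EFinM lee_fin mulr_ge0.
- by apply: measurable_funeM; exact/measurable_EFinP.
- by move=> z _; rewrite lee_fin mulr_ge0// ltW.
rewrite ge0_integralZl//; last 2 first.
- exact/measurable_EFinP.
- by move=> z _; rewrite lee_fin.
rewrite (integral_cst1 _ (probability_setT nu)) [leRHS]EFinD leeD2r//.
by rewrite EFinM lee_wpmul2l.
Qed.

End Moments.

(** * Time grid and moments *)

Section TimeGrid.
Context {R : realType}.

Lemma nonincreasing_to0_ge0 (u : nat -> R) n : nonincreasing_to0 u ->
  (0 < n)%N -> 0 <= u n.
Proof.
move=> [ni u0] n0; apply: (cvgr_to_le u0); exists n => // m /= nm.
by apply: ni; rewrite n0.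
Qed.

Variable gamma : nat -> R.
Hypothesis gamma_gt0 : forall n, (0 < n)%N -> 0 < gamma n.
Hypothesis gamma_sum : tau gamma n @[n --> \oo] --> +oo.

Lemma tauS n : tau gamma n.+1 = tau gamma n + gamma n.+1.
Proof. by rewrite /tau big_nat_recr. Qed.

Lemma tau_le m n : (m <= n)%N -> tau gamma m <= tau gamma n.
Proof.
move=> /subnK <-; elim: (n - m)%N => [|k IH]; first by rewrite add0n.
by rewrite addSn tauS (le_trans IH)// lerDl ltW// gamma_gt0.
Qed.

Lemma step_indexP t : 0 <= t ->
  tau gamma (step_index gamma t) <= t < tau gamma (step_index gamma t).+1.
Proof.
move=> t0; suff ex : [set n | tau gamma n <= t < tau gamma n.+1] !=set0.
  exact: (xgetPex 0%N ex).
have ext : exists n, t < tau gamma n.+1.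
  have /cvgryPgt/(_ t)[N _ HN] := gamma_sum.
  by exists N; apply: HN => /=.
exists (ex_minn ext); case: ex_minnP => -[|n] tn min_n /=.
  by rewrite tn andbT /tau big_geq.
by rewrite tn andbT leNgt; apply/negP => /min_n; rewrite ltnn.
Qed.

Lemma step_index_ge N t : 0 <= t -> tau gamma N <= t -> (N <= step_index gamma t)%N.
Proof.
move=> t0 Nt; rewrite leqNgt; apply/negP => /tau_le.
by have /andP[_ h] := step_indexP t0; move=> /(lt_le_trans h); rewrite ltNge Nt.
Qed.

Lemma step_index_le s t : 0 <= s -> s <= t ->
  (step_index gamma s <= step_index gamma t)%N.
Proof.
move=> s0 st; apply: step_index_ge; first exact: le_trans st.
by have /andP[h _] := step_indexP s0; exact: le_trans st.
Qed.

End TimeGrid.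

Section MomentBound.
Context {R : realType} {D : nat}.
Local Notation E := (borel R D).
Context {dY : measure_display} {OmegaY : measurableType dY}.
Variables (P : probability OmegaY R) (gamma : nat -> R)
  (K : nat -> R.-pker E ~> E) (y : nat -> {RV P >-> E}).
Hypothesis gamma_gt0 : forall n, (0 < n)%N -> 0 < gamma n.
Hypothesis gamma_to0 : nonincreasing_to0 gamma.
Hypothesis Hy : markov_chain K y.

(** Once [gamma n * al <= 1], the affine recursion of [moment_drift] leaves every
half-line below a point [M >= be / al] invariant. *)
Lemma lyapunov_moment_bound (V : 'rV[R]_D -> R) (n0 : nat) (al be : R) :
  measurable_fun [set: E] (V : E -> R) -> (forall z, 0 <= V z) ->
  (forall n, \int[law (y n)]_z (V z)%:E < +oo)%E -> 0 < al -> 0 < be ->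
  (forall n, (n0 <= n)%N -> forall z, msupport (law (y n)) z ->
    (chain_generator gamma K n V z <= (- al * V z + be)%:E)%E) ->
  exists n1 M, forall n, (n1 <= n)%N -> (\int[law (y n)]_z (V z)%:E <= M%:E)%E.
Proof.
move=> mV V0 Vfin al0 be0 drift.
have [N _ HN] : \forall n \near \oo, gamma n < al^-1.
  have [_ g0] := gamma_to0; apply: (cvgr_lt 0) => //; by rewrite invr_gt0.
pose n1 := maxn n0 N.
have m1fin : (\int[law (y n1)]_z (V z)%:E)%E \is a fin_num.
  by rewrite ge0_fin_numE// integral_ge0// => z _; rewrite lee_fin.
pose M := Num.max (fine (\int[law (y n1)]_z (V z)%:E)%E) (be / al).
exists n1, M => n /subnK <-; elim: (n - n1)%N => [|k IH].
  by rewrite add0n -(fineK m1fin) lee_fin le_max lexx.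
rewrite addSn; set m := (k + n1)%N in IH *.
have mn1 : (n1 <= m)%N by rewrite leq_addl.
have gm : gamma m.+1 * al <= 1.
  rewrite -ler_pdivlMr// div1r ltW// HN//= (leq_trans (leq_maxr n0 N))//.
  exact: leq_trans mn1 _.
have gam0 : 0 < gamma m.+1 by exact: gamma_gt0.
have step := moment_drift (markov_chain_mixture m Hy) mV V0 gam0 (ltW be0) gm _ IH.
apply: (le_trans (step _)).
  apply: (@filterS _ _ (ae_filter_ringOfSetsType (law (y m))) _ _ _ (ae_msupport _)).
  by move=> z zs; apply: drift => //; exact: leq_trans (leq_maxl _ _) mn1.
rewrite lee_fin mulrBl mul1r -addrA gerDl addrC subr_le0 -mulrA ler_pM2l//.
by rewrite mulrC -ler_pdivrMr// le_max lexx orbT.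
Qed.

(** Both forms of the moment hypothesis give what the tracking argument uses: a
bound, from some index on, for the mean of [chi d1] along the chain. *)
Lemma eventual_chi_bound (d1 : multi_index D) :
  (exists2 d : multi_index D, mi_le d1 d &
     (exists M2 : R,
        (ereal_sup [set 'E_P[(chi d \o y n)%R] | n in [set: nat]] <= M2%:E)%E)
     \/
     (exists V : 'rV[R]_D -> R,
        [/\ measurable_fun [set: borel R D] (V : borel R D -> R),
            forall z, 0 <= V z,
            forall n, ('E_P[(V \o y n)%R] < +oo)%E
          & exists n0 : nat, exists a alpha beta : R,
            [/\ (1 <= n0)%N, [/\ 0 < a, 0 < alpha & 0 < beta],
                forall z, a < euclidean_norm z -> chi d z <= V z
              & forall n, (n0 <= n)%N -> forall z, msupport (law (y n)) z ->
                  (chain_generator gamma K n V z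
                     <= (- alpha * V z + beta)%:E)%E]])) ->
  exists n1 M, [/\ (0 < n1)%N, 0 <= M & forall n, (n1 <= n)%N ->
    (\int[law (y n)]_z (chi d1 z)%:E <= M%:E)%E].
Proof.
move=> [d d1d H].
suff [n1 [M HM]] : exists n1 M, forall n, (n1 <= n)%N ->
    (\int[law (y n)]_z (chi d z)%:E <= M%:E)%E.
  exists n1.+1, `|M|; split=> // n /ltnW n1n.
  apply: (@le_trans _ _ (\int[law (y n)]_z (chi d z)%:E)%E).
    apply: ge0_le_integral => //.
    - by move=> z _; rewrite lee_fin chi_ge0.
    - by apply/measurable_EFinP; exact: measurable_chi.
    - by apply/measurable_EFinP; exact: measurable_chi.
    - by move=> z _; rewrite lee_fin chi_le.
  by rewrite (le_trans (HM _ n1n))// lee_fin ler_norm.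
have lawE (V : E -> R) n : measurable_fun setT V -> (forall z, 0 <= V z) ->
    (\int[law (y n)]_z (V z)%:E = 'E_P[V \o y n])%E.
  move=> mV V0; rewrite unlock ge0_integral_distribution//; exact/measurable_EFinP.
case: H => [[M2 HM2]|[V [mV V0 Vfin [n0 [a [al [be [n00 [a0 al0 be0] chiV drift]]]]]]]].
  exists 0%N, M2 => n _; rewrite lawE; [|exact: measurable_chi|exact: chi_ge0].
  by apply: le_trans HM2; apply: ereal_sup_ubound; exists n.
have [n|n1 [M HM]] := lyapunov_moment_bound mV V0 _ al0 be0 drift.
  by rewrite lawE.
have [c c0 Hc] := chi_bounded_on_ball d a.
exists n1, (M + c) => n n1n.
apply: (@le_trans _ _ (\int[law (y n)]_z ((V z)%:E + c%:E))%E).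
  apply: ge0_le_integral => //.
  - by move=> z _; rewrite lee_fin chi_ge0.
  - by apply/measurable_EFinP; exact: measurable_chi.
  - by apply: emeasurable_funD => //; exact/measurable_EFinP.
  - move=> z _; rewrite -EFinD lee_fin.
    have [/Hc zc|/chiV zV] := leP (euclidean_norm z) a.
      by rewrite (le_trans zc)// lerDr.
    by rewrite (le_trans zV)// lerDl.
rewrite ge0_integralD//; last 2 first.
- by move=> z _; rewrite lee_fin.
- exact/measurable_EFinP.
by rewrite (integral_cst1 _ (probability_setT _)) EFinD leeD2r// HM.
Qed.

End MomentBound.

(** * The chain tracks the semiflow *)

Section Tracking.
Context {R : realType} {D : nat}.
Local Notation E := (borel R D).

Lemma Cnorm_ge0 N (f : 'rV[R]_D -> R) : (0 <= Cnorm N f)%E.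
Proof. by apply: sume_ge0 => j _; exact: supnorm_ge0. Qed.

Lemma Cnorm_le (N : multi_index D) (g : 'rV[R]_D -> R) (c : R) :
  (forall j, mi_le j N -> forall z, `|mpartial j g z| <= c) ->
  (Cnorm N g <= (\sum_(j : {dffun forall i : 'I_D, 'I_(N i).+1}) c)%:E)%E.
Proof.
move=> gc; rewrite /Cnorm -sumEFin; apply: lee_sum => j _.
by apply/supnorm_leP => z; apply: gc => i; rewrite -ltnS ltn_ord.
Qed.

Lemma chain_generatorE (gamma : nat -> R) (K : nat -> R.-pker E ~> E) n
    (g : 'rV[R]_D -> R) z : bounded_meas (g : E -> R) ->
  chain_generator gamma K n g z =
    ((gamma n.+1)^-1 * (\int[K n z]_u g u - g z))%:E.
Proof.
move=> bg; have k1 := prob_kernel (s := K n) z.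
have bgz := bounded_measB bg (bounded_meas_cst (g z)).
have fgz := integrable_fin_num measurableT (bounded_meas_integrable k1 bgz).
rewrite /chain_generator -(fineK fgz) -EFinM; congr (_ * _)%:E.
rewrite -[LHS]/(\int[K n z]_u (g u - cst (g z) u)) RintegralB//.
- by rewrite [X in _ - X]Rintegral_cst1.
- exact: bounded_meas_integrable.
- exact: bounded_meas_integrable k1 (bounded_meas_cst _).
Qed.

Context {dY : measure_display} {OmegaY : measurableType dY}.
Variables (Pt : R -> R.-pker E ~> E).
Variables (P : probability OmegaY R) (gamma : nat -> R)
  (K : nat -> R.-pker E ~> E) (y : nat -> {RV P >-> E}).
Hypothesis ck : chapman_kolmogorov Pt.
Hypothesis P0 : starts_at_identity Pt.
Hypothesis gamma_gt0 : forall n, (0 < n)%N -> 0 < gamma n.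
Hypothesis Hy : markov_chain K y.

(** Compare the chain run up to time [m] with the chain stopped at time [k] and
then continued by the semigroup, and let [k] descend from [m] to [n]. Each descent
changes one move only, applied to the function [g = P_s f], for which the
generators [L g = P_s L f] and [L L g] keep the bounds they have for [f]. *)
Lemma telescoped_error (f f1 f2 W : 'rV[R]_D -> R) (A M G : R) (n m : nat) :
  is_generator Pt f f1 -> is_generator Pt f1 f2 -> (forall z, `|f2 z| <= 1) ->
  measurable_fun [set: E] (W : E -> R) -> (forall z, 0 <= W z) -> 0 <= A ->
  (n <= m)%N ->
  (forall k, (n <= k)%N -> \int[law (y k)]_z (W z)%:E <= M%:E)%E ->
  (forall k, (n <= k)%N -> gamma k.+1 <= G) ->
  (forall s k, 0 <= s <= tau gamma m - tau gamma n -> (n <= k)%N ->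
    {ae law (y k), forall z, `|semigroup Pt s f1 z - (gamma k.+1)^-1 *
      (\int[K k z]_u semigroup Pt s f u - semigroup Pt s f z)| <= A * W z}) ->
  `|\int[law (y m)]_z f z -
    \int[law (y n)]_z semigroup Pt (tau gamma m - tau gamma n) f z| <=
  (tau gamma m - tau gamma n) * (A * M + G).
Proof.
move=> ff1 f12 f2b mW W0 A0 nm WM gG Hae.
have [bf bf1] := is_generator_bounded ff1; have [_ bf2] := is_generator_bounded f12.
suff H j : (j <= m - n)%N ->
  `|\int[law (y m)]_z f z -
    \int[law (y (m - j)%N)]_z semigroup Pt (tau gamma m - tau gamma (m - j)%N) f z| <=
  (tau gamma m - tau gamma (m - j)%N) * (A * M + G).
  by have := H (m - n)%N (leqnn _); rewrite subKn.
elim: j => [|j IH] jmn.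
  rewrite subn0 subrr mul0r; under [X in _ - X]eq_Rintegral do rewrite P0//.
  by rewrite subrr normr0.
set k := (m - j.+1)%N.
have kS : (m - j)%N = k.+1 by rewrite /k subnSK// (leq_trans jmn)// leq_subr.
have {}IH := IH (ltnW jmn); rewrite kS in IH.
have nk : (n <= k)%N.
  by rewrite /k leq_subRL ?(leq_trans jmn) ?leq_subr// addnC -leq_subRL.
have km : (k.+1 <= m)%N by rewrite -kS leq_subr.
set s := tau gamma m - tau gamma k.+1 in IH.
have s0 : 0 <= s by rewrite subr_ge0 tau_le.
have gam0 : 0 < gamma k.+1 by exact: gamma_gt0.
have sE : tau gamma m - tau gamma k = gamma k.+1 + s.
  by rewrite /s tauS; ring.
have sle : 0 <= s <= tau gamma m - tau gamma n.
  by rewrite s0 lerD2l lerN2 tau_le// ltnW.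
have sf2 z : `|semigroup Pt s f2 z| <= 1 by exact: semigroup_le.
have := one_step_error ck P0 (markov_chain_mixture k Hy)
  (is_generator_semigroup ck ff1 s0) (is_generator_semigroup ck f12 s0)
  sf2 gam0 A0 mW W0 (WM _ nk) (Hae s k sle nk).
have -> : \int[law (y k)]_z semigroup Pt (gamma k.+1) (semigroup Pt s f) z =
    \int[law (y k)]_z semigroup Pt (gamma k.+1 + s) f z.
  by apply: eq_Rintegral => z _; rewrite semigroupD// ltW.
rewrite -sE mulr1 => step.
set I := (X in `|X - _|); set J := (X in _ - X).
set I' := \int[law (y k.+1)]_z semigroup Pt s f z in IH step.
have -> : I - J = (I - I') + (I' - J) by ring.
rewrite (le_trans (ler_normD _ _))// [leRHS](_ : _ = s * (A * M + G) +
  gamma k.+1 * (A * M + G)); last by rewrite sE; ring.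
apply: lerD; first exact: IH.
apply: (le_trans step). apply: ler_wpM2l; first exact: ltW.
by rewrite lerD2l gG.
Qed.

End Tracking.

Section GapBound.
Context {R : realType} {D : nat}.
Local Notation E := (borel R D).
Context {dY : measure_display} {OmegaY : measurableType dY}.
Variables (Pt : R -> R.-pker E ~> E).
Variables (P : probability OmegaY R) (gamma eps : nat -> R)
  (K : nat -> R.-pker E ~> E) (y : nat -> {RV P >-> E}).
Hypothesis ck : chapman_kolmogorov Pt.
Hypothesis P0 : starts_at_identity Pt.
Hypothesis gamma_gt0 : forall n, (0 < n)%N -> 0 < gamma n.
Hypothesis gamma_to0 : nonincreasing_to0 gamma.
Hypothesis gamma_sum : tau gamma n @[n --> \oo] --> +oo.
Hypothesis eps_to0 : nonincreasing_to0 eps.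
Hypothesis Hy : markov_chain K y.
Variables (d1 N1 N2 : multi_index D).
Hypothesis H1 : exists M1 : R, forall f, generator_domain Pt f -> class_Cb N1 f ->
     forall n, (1 <= n)%N -> forall z, msupport (law (y n)) z ->
       (`|(generator Pt f z)%:E - chain_generator gamma K n f z|
          <= M1%:E * (chi d1 z)%:E * Cnorm N1 f * (eps n)%:E)%E.
Hypothesis H2 : forall T : R, 0 < T -> exists CT : R,
     forall t : R, 0 <= t <= T -> forall j, mi_le j N1 -> forall f, class_Cb N2 f ->
       class_Cb N1 (semigroup Pt t f) /\
       forall z, (`|mpartial j (semigroup Pt t f) z|%:E <= CT%:E * Cnorm N2 f)%E.
Variables (n1 : nat) (M : R).
Hypothesis n1_gt0 : (0 < n1)%N.
Hypothesis M_ge0 : 0 <= M.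
Hypothesis chiM : forall n, (n1 <= n)%N ->
  (\int[law (y n)]_z (chi d1 z)%:E <= M%:E)%E.

(** The comparison of generators is needed for [P_s f] and not only for [f]: the
regularity of the limit semigroup bounds the [N1]-norm of [P_s f] by the [N2]-norm
of [f], uniformly for [s <= T]. *)
Lemma generator_mismatch T : 0 < T -> exists2 C, 0 <= C &
  forall f f1, is_generator Pt f f1 -> class_Cb N2 f -> (Cnorm N2 f <= 1)%E ->
  forall s n, 0 <= s <= T -> (0 < n)%N ->
  {ae law (y n), forall z, `|semigroup Pt s f1 z - (gamma n.+1)^-1 *
      (\int[K n z]_u semigroup Pt s f u - semigroup Pt s f z)|
      <= C * eps n * chi d1 z}.
Proof.
move=> T0; have [M1 HM1] := H1; have [CT HCT] := H2 T0.
pose S := \sum_(j : {dffun forall i : 'I_D, 'I_(N1 i).+1}) `|CT|.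
have S0 : 0 <= S by apply: sumr_ge0.
exists (`|M1| * S); first by rewrite mulr_ge0.
move=> f f1 ff1 fN2 fle s n sT n0.
have s0 : 0 <= s by case/andP: sT.
have gs := is_generator_semigroup ck ff1 s0.
have [bf _] := is_generator_bounded ff1.
apply: (@filterS _ _ (ae_filter_ringOfSetsType (law (y n))) _ _ _ (ae_msupport _)).
move=> z zs.
have sN1 : class_Cb N1 (semigroup Pt s f).
  by have [] := HCT s sT (fun=> 0%N) (fun i => leq0n _) f fN2.
have := HM1 _ (ex_intro _ _ gs) sN1 n n0 z zs.
rewrite (generatorE gs) chain_generatorE; last exact: semigroup_bounded.
rewrite -EFinB abse_EFin => h; rewrite -lee_fin; apply: (le_trans h).
have CS : (Cnorm N1 (semigroup Pt s f) <= S%:E)%E.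
  apply: Cnorm_le => j jN1 u; rewrite -lee_fin.
  have [_ /(_ u) hu] := HCT s sT j jN1 f fN2; apply: (le_trans hu).
  apply: (@le_trans _ _ (`|CT|%:E * Cnorm N2 f)%E).
    by rewrite lee_wpmul2r ?Cnorm_ge0// lee_fin ler_norm.
  by rewrite -[leRHS]mule1 lee_wpmul2l// lee_fin.
have e0 := nonincreasing_to0_ge0 eps_to0 n0; have c0 := chi_ge0 d1 z.
rewrite (_ : _ * _ * _ * chi d1 z = `|M1| * chi d1 z * S * eps n); last by ring.
rewrite !EFinM lee_wpmul2r ?lee_fin//.
apply: (@le_trans _ _ (`|M1|%:E * (chi d1 z)%:E * Cnorm N1 (semigroup Pt s f))%E).
  by rewrite lee_wpmul2r ?Cnorm_ge0// lee_wpmul2r ?lee_fin// ler_norm.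
by rewrite lee_wpmul2l// -EFinM lee_fin mulr_ge0.
Qed.

Local Notation mu := (interpolated_law gamma y).
Local Notation dF := (class_dist (test_class Pt N2)).

Lemma test_classP f : test_class Pt N2 f -> exists f1 f2,
  [/\ is_generator Pt f f1, is_generator Pt f1 f2, forall z, `|f1 z| <= 1,
      forall z, `|f2 z| <= 1 & class_Cb N2 f /\ (Cnorm N2 f <= 1)%E].
Proof.
move=> [/generator_spec ff1 fN2 /generator_spec f12 fle].
have s1 := supnorm_ge0 (generator Pt f).
have s2 := supnorm_ge0 (generator Pt (generator Pt f)).
have s3 := Cnorm_ge0 N2 f.
exists (generator Pt f), (generator Pt (generator Pt f)); split=> //.
- apply/supnorm_leP/(le_trans _ fle); rewrite -addeA; apply: leeDl.
  exact: adde_ge0.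
- apply/supnorm_leP/(le_trans _ fle).
  by apply: (le_trans (leeDr _ s1)); apply: leeDl.
- by split=> //; apply: le_trans fle; apply: leeDr; exact: adde_ge0.
Qed.

(** With [n] the index of the step containing [t], the telescoped error accounts for
the grid times, and the Lipschitz bound of the semigroup for the offset between [s]
and the grid, which is at most one step. *)
Lemma flow_gap_le T : 0 < T -> exists2 C, 0 < C &
  forall t, 0 <= t -> (n1 <= step_index gamma t)%N ->
    (flow_gap (semiflow Pt) dF mu T t <=
      (C * Num.max (gamma (step_index gamma t)) (eps (step_index gamma t)))%:E)%E.
Proof.
(* [T'] bounds the length of the grid interval between the steps containing [t]
   and [t + s], which may exceed [s] by one step. *)
move=> T0; pose T' := T + gamma 1%N.
have T'0 : 0 < T' by rewrite addr_gt0// gamma_gt0.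
have [A A0 HA] := generator_mismatch T'0.
exists (T' * (A * M + 1) + 1).
  by rewrite ltr_wpDl// mulr_ge0 ?(ltW T'0)// addr_ge0// mulr_ge0.
move=> t t0; set n := step_index gamma t => n1n.
have n0 : (0 < n)%N by exact: leq_trans n1n.
have [gni _] := gamma_to0; have [eni _] := eps_to0.
set mx := Num.max _ _.
have gmx : gamma n <= mx by rewrite le_max lexx.
have emx : eps n <= mx by rewrite le_max lexx orbT.
apply: ge_ereal_sup => _ [s /= + <-]; rewrite in_itv/= => /andP[s0 sT].
apply: ge_ereal_sup => _ [f Ff <-].
have [f1 [f2 [ff1 f12 f1b f2b [fN2 fle]]]] := test_classP Ff.
have [bf bf1] := is_generator_bounded ff1.
have fin (nu : probability E R) : (\int[nu]_z (f z)%:E)%E \is a fin_num.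
  exact/integrable_fin_num/(bounded_meas_integrable (probability_setT nu)).
have ts0 : 0 <= t + s by rewrite addr_ge0.
pose m := step_index gamma (t + s).
have nm : (n <= m)%N by apply: step_index_le => //; rewrite lerDl.
have /andP[tn tn1] := step_indexP gamma_sum t0.
have /andP[tm tm1] := step_indexP gamma_sum ts0.
rewrite -/n tauS in tn tn1; rewrite -/m tauS in tm tm1.
have g1 : gamma n.+1 <= gamma 1%N by exact: gni.
have gn : gamma n.+1 <= gamma n by by apply: gni; rewrite n0/=.
have gm : gamma m.+1 <= gamma n by apply: gni; rewrite n0 leqW.
set r := tau gamma m - tau gamma n.
have r0 : 0 <= r by rewrite subr_ge0 tau_le.
have rT : r <= T' by rewrite /r /T'; lra.
have rs : `|r - s| <= gamma n by rewrite ler_norml /r; lra.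
rewrite -(fineK (fin (mu (t + s)))) -(fineK (fin (semiflow Pt (mu t) s))).
rewrite -EFinB abse_EFin lee_fin.
rewrite -[X in _ - X]/(\int[semiflow Pt (mu t) s]_z f z).
rewrite (Rintegral_mixture (semiflow_mixture (mu t) Pt s) bf).
rewrite -[X in X - _]/(\int[law (y m)]_z f z).
rewrite -[X in _ - X]/(\int[law (y n)]_z semigroup Pt s f z).
have tracked : `|\int[law (y m)]_z f z - \int[law (y n)]_z semigroup Pt r f z| <=
    r * (A * eps n * M + gamma n).
  apply: (telescoped_error ck P0 gamma_gt0 Hy ff1 f12 f2b (measurable_chi d1)
    (chi_ge0 d1) _ nm).
  - by rewrite mulr_ge0// (nonincreasing_to0_ge0 eps_to0).
  - by move=> k nk; apply: chiM; exact: leq_trans nk.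
  - by move=> k nk; apply: gni; rewrite n0 leqW.
  - move=> u k /andP[u0 ur] nk.
    apply: (@filterS _ _ (ae_filter_ringOfSetsType (law (y k))) _ _ _
      (HA _ _ ff1 fN2 fle u k _ _)).
    + move=> z /le_trans; apply; rewrite ler_wpM2r ?chi_ge0//.
      by rewrite ler_wpM2l//; apply: eni; rewrite n0.
    + by rewrite u0 (le_trans ur).
    + exact: leq_trans nk.
have discretized : `|\int[law (y n)]_z semigroup Pt r f z -
    \int[law (y n)]_z semigroup Pt s f z| <= gamma n.
  have nu1 := probability_setT (law (y n)).
  rewrite -RintegralB//; last 2 first.
  - exact: bounded_meas_integrable nu1 (semigroup_bounded _ _ _).
  - exact: bounded_meas_integrable nu1 (semigroup_bounded _ _ _).
  apply: normr_Rintegral_le => //.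
    by apply: bounded_measB; exact: semigroup_bounded.
  move=> z; apply: le_trans rs; rewrite -[leRHS]mulr1.
  by have := semigroup_lipschitz ck P0 z ff1 f1b r0 s0.
set I := (X in `|X - _|); set J := (X in `|_ - X|).
set I' := \int[law (y n)]_z semigroup Pt r f z in tracked discretized.
have -> : I - J = (I - I') + (I' - J) by ring.
rewrite (le_trans (ler_normD _ _))// mulrDl mul1r lerD//; last exact: le_trans gmx.
apply: (le_trans tracked); rewrite -[leRHS]mulrA ler_pM//.
  by rewrite addr_ge0// ?mulr_ge0 ?(nonincreasing_to0_ge0 eps_to0)// ltW// gamma_gt0.
rewrite mulrDl mul1r lerD// mulrAC ler_wpM2l// mulr_ge0//.
Qed.

End GapBound.

(** * From the gap bound to pseudotrajectories *)

Section ZeroTestFunction.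
Context {R : realType} {D : nat}.
Local Notation E := (borel R D).

Lemma iter_partial_cst0 (s : seq 'I_D) :
  iter_partial s (cst 0 : 'rV[R]_D -> R) = cst 0.
Proof.
by elim: s => //= i s ->; apply/funext => x; rewrite derive_cst.
Qed.

Lemma Cnorm_cst0 (N : multi_index D) : Cnorm N (cst 0 : 'rV[R]_D -> R) = 0%E.
Proof.
apply: big1 => j _; rewrite /mpartial iter_partial_cst0.
apply/eqP; rewrite eq_le supnorm_ge0 andbT.
by apply/supnorm_leP => x; rewrite normr0.
Qed.

(** The test class is nonempty, so that the distance it defines is nonnegative
rather than [-oo]. *)
Lemma test_class_cst0 (Pt : R -> R.-pker E ~> E) (N : multi_index D) :
  test_class Pt N (cst 0).
Proof.
have g0 := is_generator_cst0 Pt.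
have s0 : supnorm (cst 0 : 'rV[R]_D -> R) = 0%E.
  apply/eqP; rewrite eq_le supnorm_ge0 andbT.
  by apply/supnorm_leP => x; rewrite normr0.
split; rewrite ?(generatorE g0).
- by exists (cst 0).
- split; last by rewrite Cnorm_cst0.
  move=> s _; rewrite iter_partial_cst0; split=> [|i _ x].
    exact: cst_continuous.
  exact: derivable_cst.
- by exists (cst 0).
- by rewrite s0 Cnorm_cst0 !adde0.
Qed.

Lemma flow_gap_ge0 (Pt : R -> R.-pker E ~> E) (N : multi_index D)
    (mu : R -> probability E R) T t : 0 < T ->
  (0 <= flow_gap (semiflow Pt) (class_dist (test_class Pt N)) mu T t)%E.
Proof.
move=> T0; apply: le_trans (ereal_sup_ubound _); last first.
  by exists 0 => //=; rewrite in_itv/= lexx ltW.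
apply: le_trans (ereal_sup_ubound _); last first.
  by exists (cst 0) => //; exact: test_class_cst0.
exact: abse_ge0.
Qed.

End ZeroTestFunction.

Section Rates.
Context {R : realType}.

(** A criterion for comparison with a possibly infinite [L], by real numbers whose
sign is known. *)
Lemma le_negative_upper_bounds (x L : \bar R) : (L < 0)%E ->
  (forall b : R, b < 0 -> (L < b%:E)%E -> (x <= b%:E)%E) -> (x <= L)%E.
Proof.
case: L => [r| |]// r0 H.
  rewrite lte_fin in r0; apply/lee_addgt0Pr => e e0.
  have hr : 0 < - r / 2 by rewrite divr_gt0// oppr_gt0.
  have m0 : 0 < Num.min e (- r / 2) by rewrite lt_min e0.
  have mr : Num.min e (- r / 2) <= - r / 2 by rewrite ge_min lexx orbT.
  have me : Num.min e (- r / 2) <= e by rewrite ge_min lexx.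
  apply: (@le_trans _ _ (r + Num.min e (- r / 2))%:E).
    by apply: H; rewrite ?lte_fin; lra.
  by rewrite -EFinD lee_fin lerD2l.
case: x H => [x| |]// H.
- have /= : (x%:E <= (Num.min x 0 - 1)%:E)%E.
    apply: H; last by rewrite ltNyr.
    have : Num.min x 0 <= 0 by rewrite ge_min lexx orbT.
    lra.
  have hx : Num.min x 0 <= x by rewrite ge_min lexx.
  by rewrite lee_fin => h; exfalso; clear r0 H; lra.
- by have := H (-1); rewrite ltNyr => /(_ (ltrN10 _) isT).
Qed.

Lemma limn_esup_lt_near (u : nat -> \bar R) (b : \bar R) :
  (limn_esup u < b)%E -> \forall n \near \oo, (u n < b)%E.
Proof.
move=> /ereal_inf_lt[_ [V VF <-] Vb]; apply: filterS VF => n Vn.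
by apply: le_lt_trans Vb; apply: ereal_sup_ubound; exists n.
Qed.

Lemma limf_esup_le_near (f : R -> \bar R) (b : R) :
  (forall e, 0 < e -> \forall t \near +oo, (f t <= (b + e)%:E)%E) ->
  (limf_esup f (pinfty_nbhs R) <= b%:E)%E.
Proof.
move=> H; apply/lee_addgt0Pr => e e0; rewrite -EFinD.
pose V := [set t | (f t <= (b + e)%:E)%E].
apply: (@le_trans _ _ (ereal_sup (f @` V))).
  by apply: ereal_inf_lbound; exists V => //; exact: H.
by apply: ge_ereal_sup => _ [t /= ft <-].
Qed.

End Rates.

Section Conclusion.
Context {R : realType}.
Variables (gamma eps : nat -> R).
Hypothesis gamma_gt0 : forall n, (0 < n)%N -> 0 < gamma n.
Hypothesis gamma_to0 : nonincreasing_to0 gamma.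
Hypothesis gamma_sum : tau gamma n @[n --> \oo] --> +oo.
Hypothesis eps_to0 : nonincreasing_to0 eps.
Local Notation idx := (step_index gamma).
Local Notation err n := (Num.max (gamma n) (eps n)).

Lemma step_index_cvg : idx t @[t --> +oo] --> \oo.
Proof.
move=> A [N _ NA]; suff : \forall t \near +oo, A (idx t) by [].
near=> t; apply: NA; apply: (step_index_ge gamma_gt0 gamma_sum);
  near: t; exact: nbhs_pinfty_ge (num_real _).
Unshelve. all: by end_near. Qed.

Variable gap : R -> \bar R.
Variables (C : R) (n1 : nat).
Hypothesis n1_gt0 : (0 < n1)%N.
Hypothesis C_gt0 : 0 < C.
Hypothesis gap_ge0 : forall t, (0 <= gap t)%E.
Hypothesis gap_le : forall t, 0 <= t -> (n1 <= idx t)%N ->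
  (gap t <= (C * err (idx t))%:E)%E.

Lemma gap_near : \forall t \near +oo, [/\ 0 < t, (n1 <= idx t)%N &
  (gap t <= (C * err (idx t))%:E)%E].
Proof.
near=> t.
have t0 : 0 < t by near: t; exact: nbhs_pinfty_gt (num_real _).
have n1t : (n1 <= idx t)%N.
  by near: t; exact: (step_index_cvg (nbhs_infty_ge n1)).
by split=> //; apply: gap_le => //; exact: ltW.
Unshelve. all: by end_near. Qed.

Lemma gap_cvg0 : gap t @[t --> +oo] --> 0%E.
Proof.
apply: (@squeeze_cvge _ _ _ _ (cst 0%E) _
  (fun t => (C * (gamma (idx t) + eps (idx t)))%:E)).
- near=> t; rewrite gap_ge0/=.
  have [t0 n1t h] : [/\ 0 < t, (n1 <= idx t)%N &
    (gap t <= (C * err (idx t))%:E)%E] by near: t; exact: gap_near.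
  have n0 : (0 < idx t)%N by exact: leq_trans n1t.
  apply: (le_trans h); rewrite lee_fin; apply: ler_wpM2l; first exact: ltW.
  by rewrite ge_max lerDl lerDr (nonincreasing_to0_ge0 eps_to0)// ltW// gamma_gt0.
- exact: cvg_cst.
- apply: cvg_EFin; first by near=> t.
  have [_ g0] := gamma_to0; have [_ e0] := eps_to0.
  have lim0 : C * (gamma n + eps n) @[n --> \oo] --> (0 : R).
    rewrite -[X in _ --> X](mulr0 C) -[X in C * X](addr0 0).
    by apply: cvgMr; exact: cvgD.
  exact: (cvg_comp _ _ step_index_cvg lim0).
Unshelve. all: by end_near. Qed.

(** Let [b < 0] lie above the limsup of [ln (err n) / tau n]. Then eventually
[ln (gap t) <= ln C + b tau n], and since [tau n >= t - gamma 1], dividing by [t]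
leaves [b + O(1 / t)]. *)
Lemma gap_rate : (0 < rate gamma eps)%E ->
  (limf_esup (fun t : R => t^-1%:E * lne (gap t)) (pinfty_nbhs R)
    <= - rate gamma eps)%E.
Proof.
rewrite /rate oppe_gt0 oppeK => L0; apply: le_negative_upper_bounds => // b b0 Lb.
have ub := limn_esup_lt_near Lb.
apply: limf_esup_le_near => e e0; near=> t.
have [t0 n1t h] : [/\ 0 < t, (n1 <= idx t)%N &
  (gap t <= (C * err (idx t))%:E)%E] by near: t; exact: gap_near.
set n := idx t in n1t h *.
have n0 : (0 < n)%N by exact: leq_trans n1t.
have err0 : 0 < err n by rewrite lt_max gamma_gt0.
have tau0 : 0 < tau gamma n.
  apply: (@lt_le_trans _ _ (tau gamma 1)); last exact: tau_le.
  by rewrite /tau big_nat1 gamma_gt0.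
have hb : ln (err n) <= b * tau gamma n.
  rewrite -ler_pdivrMr// -lee_fin ltW// /n.
  by near: t; exact: (step_index_cvg ub).
have /andP[tn] := step_indexP gamma_sum (ltW t0).
rewrite -/n tauS => tn1.
have g1 : gamma n.+1 <= gamma 1%N by have [gni _] := gamma_to0; exact: gni.
have hb' : b * tau gamma n <= b * (t - gamma 1%N).
  by rewrite ler_nM2l//; lra.
have big : (ln C - b * gamma 1%N) / e <= t by near: t; exact: nbhs_pinfty_ge (num_real _).
have lb : (lne (gap t) <= (ln C + ln (err n))%:E)%E.
  rewrite -lnM ?posrE// -lne_EFin ?mulr_gt0// lee_lne// in_itv/= ?leey ?andbT//.
  by rewrite lee_fin mulr_ge0// ltW.
apply: (@le_trans _ _ (t^-1%:E * (ln C + ln (err n))%:E)%E).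
  by apply: lee_wpmul2l => //; rewrite lee_fin invr_ge0 ltW.
rewrite -EFinM lee_fin mulrC ler_pdivrMr//.
move: big; rewrite ler_pdivrMr// => big.
have -> : (b + e) * t = b * t + t * e by ring.
lra.
Unshelve. all: by end_near. Qed.

End Conclusion.
Theorem theorem2p6 (R : realType) (D : nat)
  (* the limit process *)
  (dX : measure_display) (OmegaX : measurableType dX)
  (Pt : R -> R.-pker (borel R D) ~> (borel R D))
  (Q : borel R D -> probability OmegaX R) (X : R -> {mfun OmegaX >-> borel R D})
  (HX : homogeneous_markov_process Pt Q X)
  (* the step sequence and the chain *)
  (gamma : nat -> R)
  (gamma_gt0 : forall n, (0 < n)%N -> 0 < gamma n)
  (gamma_to0 : nonincreasing_to0 gamma)
  (gamma_sum : tau gamma n @[n --> \oo] --> +oo)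
  (dY : measure_display) (OmegaY : measurableType dY)
  (P : probability OmegaY R)
  (K : nat -> R.-pker (borel R D) ~> (borel R D))
  (y : nat -> {RV P >-> borel R D})
  (Hy : markov_chain K y)
  (d1 N1 N2 : multi_index D) (N12 : mi_le N1 N2)
  (* convergence of generators *)
  (eps : nat -> R) (eps_to0 : nonincreasing_to0 eps)
  (H1 : exists M1 : R, forall f, generator_domain Pt f -> class_Cb N1 f ->
     forall n, (1 <= n)%N -> forall z, msupport (law (y n)) z ->
       (`|(generator Pt f z)%:E - chain_generator gamma K n f z|
          <= M1%:E * (chi d1 z)%:E * Cnorm N1 f * (eps n)%:E)%E)
  (* regularity of the limit semigroup *)
  (H2 : forall T : R, 0 < T -> exists CT : R,
     forall t : R, 0 <= t <= T -> forall j, mi_le j N1 -> forall f, class_Cb N2 f ->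
       class_Cb N1 (semigroup Pt t f) /\
       forall z, (`|mpartial j (semigroup Pt t f) z|%:E <= CT%:E * Cnorm N2 f)%E)
  (* uniform boundedness of moments *)
  (H3 : exists2 d : multi_index D, mi_le d1 d &
     (exists M2 : R,
        (ereal_sup [set 'E_P[(chi d \o y n)%R] | n in [set: nat]] <= M2%:E)%E)
     \/
     (exists V : 'rV[R]_D -> R,
        [/\ measurable_fun [set: borel R D] (V : borel R D -> R),
            forall z, 0 <= V z,
            forall n, ('E_P[(V \o y n)%R] < +oo)%E
          & exists n0 : nat, exists a alpha beta : R,
            [/\ (1 <= n0)%N, [/\ 0 < a, 0 < alpha & 0 < beta],
                forall z, a < euclidean_norm z -> chi d z <= V z
              & forall n, (n0 <= n)%N -> forall z, msupport (law (y n)) z ->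
                  (chain_generator gamma K n V z
                     <= (- alpha * V z + beta)%:E)%E]])) :
  let mu := interpolated_law gamma y in
  let dF := class_dist (test_class Pt N2) in
  asymptotic_pseudotrajectory (semiflow Pt) dF mu /\
  ((0 < rate gamma eps)%E ->
   lambda_pseudotrajectory (rate gamma eps) (semiflow Pt) dF mu).
Proof.
move=> mu dF.
have ck := markov_process_ck HX.
have P0 := markov_process_id HX.
have [n1 [M [n10 M0 chiM]]] := eventual_chi_bound gamma_gt0 gamma_to0 Hy H3.
have gapP T : 0 < T -> exists2 C, 0 < C & forall t, 0 <= t ->
    (n1 <= step_index gamma t)%N -> (flow_gap (semiflow Pt) dF mu T t <=
      (C * Num.max (gamma (step_index gamma t)) (eps (step_index gamma t)))%:E)%E.
  exact: (flow_gap_le ck P0 gamma_gt0 gamma_to0 gamma_sum eps_to0 Hy H1 H2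
    n10 M0 chiM).
split=> [T T0|rate0 T T0]; have [C C0 gapC] := gapP T T0.
- apply: (gap_cvg0 gamma_gt0 gamma_to0 gamma_sum eps_to0 n10 C0 _ gapC) => t.
  exact: flow_gap_ge0.
- apply: (gap_rate gamma_gt0 gamma_to0 gamma_sum n10 C0 _ gapC) => // t.
  exact: flow_gap_ge0.
Qed.
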